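(* Let $X_1,\dots,X_n$ be independent copies of a random vector $X\in\mathbb{R}^d$ with $\mathbb{E}\|X\|^2<\infty$. Assume that for a known constant $\kappa>0$, for any $\theta\in\mathbb{R}^d$, $$\mathbb{E}\bigl(\langle\theta,X-\mathbb{E}(X)\rangle^4\bigr)\le\kappa\,\mathbb{E}\bigl(\langle\theta,X-\mathbb{E}(X)\rangle^2\bigr)^2 .$$ Let $\epsilon\in(0,1)$ and let $$\widehat N(\theta)=\inf_{\xi\in\mathbb{R}}\inf\Biggl\{\rho>0\,:\,\sum_{i=1}^n\psi\biggl\{\lambda\biggl[\frac{(\langle\theta,X_i\rangle-\xi)^2}{\rho}-1\biggr]\biggr\}\le0\Biggr\},\qquad\lambda=\sqrt{\frac{2}{(\kappa+2\sqrt\kappa)n}\bigl[\log(\epsilon^{-1})+0.73(d+1)\bigr]} .$$ If the sample size satisfies $$n>\Biggl[20(\kappa^{1/2}+1)(d+1)^{1/2}+\Bigl(\frac52+\frac1{2(\kappa+2\kappa^{1/2})}\Bigr)\sqrt{2(\kappa+2\kappa^{1/2})\bigl[\log(\epsilon^{-1})+0.73(d+1)\bigr]}\Biggr]^2,$$ then with probability at least $1-2\epsilon$, for any $\theta\in\mathbb{R}^d$, $$\left|\frac{\mathbb{E}\bigl(\langle\theta,X-\mathbb{E}(X)\rangle^2\bigr)}{\widehat N(\theta)}-1\right|\le\frac{\mu}{1-2\mu},$$ where $$\mu=\sqrt{\frac{2(\kappa+2\kappa^{1/2})}{n}\bigl[\log(\epsilon^{-1})+0.73(d+1)\bigr]}+6.81(\kappa^{1/2}+1)\sqrt{\frac{2(d+1)}{n}}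 ,$$ and, when $\kappa\ge1$ (which is automatic unless $X$ is almost surely constant), $\frac{\mu}{1-2\mu}=\mathbf{O}\Bigl(\sqrt{\kappa[d+\log(\epsilon^{-1})]/n}\Bigr)$.
   Context: $\psi:\mathbb{R}\to\mathbb{R}$ is $\psi(x)=\log2$ for $x\ge1$, $\psi(x)=-\log(1-x+x^2/2)$ for $0\le x\le1$, $\psi(x)=-\psi(-x)$ for $x\le0$. Convention: $0/0=1$ and $z/0=+\infty$ for $z>0$. $A=\mathbf{O}(B)$ means $A\le cB$ for a numerical constant $c$. *)

(* Defs.v *)
From mathcomp Require Import all_boot all_order all_algebra.
From mathcomp Require Import all_classical all_reals all_analysis.

Set Implicit Arguments.
Unset Strict Implicit.
Unset Printing Implicit Defensive.

Import Order.TTheory GRing.Theory Num.Theory.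
Import numFieldNormedType.Exports.

Local Open Scope classical_set_scope.
Local Open Scope ring_scope.

(* The library's norm on 'rV[R]_d is the sup norm; dot and enorm are the
   Euclidean inner product and norm. *)
Definition dot (R : realType) (d : nat) (u v : 'rV[R]_d) : R :=
  \sum_(j < d) u ord0 j * v ord0 j.

Definition enorm (R : realType) (d : nat) (u : 'rV[R]_d) : R :=
  Num.sqrt (dot u u).

(* R^d with its Borel sigma-algebra (the carrier is convertible to 'rV[R]_d). *)
Notation borelRV R d := (g_sigma_algebraType (@open 'rV[R]_d)).

Definition mutually_independent (R : realType)
    (disp disp' : measure_display) (T : measurableType disp)
    (T' : measurableType disp') (P : probability T R) (I : finType)
    (Y : I -> {RV P >-> T'}) : Prop :=
  forall (J : {set I}) (B : I -> set T'), (forall i, measurable (B i)) ->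
    P (\bigcap_(i in [set` J]) (Y i @^-1` B i)) =
    (\prod_(i in J) P (Y i @^-1` B i))%E.

Definition identically_distributed (R : realType)
    (disp disp' : measure_display) (T : measurableType disp)
    (T' : measurableType disp') (P : probability T R)
    (Y Z : {RV P >-> T'}) : Prop :=
  forall B : set T', measurable B -> distribution P Y B = distribution P Z B.

Definition independent_copies (R : realType)
    (disp disp' : measure_display) (T : measurableType disp)
    (T' : measurableType disp') (P : probability T R) (I : finType)
    (Y : I -> {RV P >-> T'}) (X : {RV P >-> T'}) : Prop :=
  mutually_independent Y /\ forall i, identically_distributed (Y i) X.

Section Moments.
Context (R : realType) (disp : measure_display) (T : measurableType disp).
Context (P : probability T R) (d : nat).

(* Only meaningful when the coordinates of X are integrable. *)
Definition mean_vector (X : T -> 'rV[R]_d) : 'rV[R]_d :=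
  \row_(j < d) fine 'E_P[fun w => X w ord0 j].

Definition central_moment (k : nat) (X : T -> 'rV[R]_d) (theta : 'rV[R]_d) :
    \bar R :=
  'E_P[fun w => dot theta (X w - mean_vector X) ^+ k].

End Moments.

Definition psi (R : realType) (x : R) : R :=
  let psi_nneg (y : R) :=
    if 1 <= y then ln 2 else - ln (1 - y + y ^+ 2 / 2) in
  if 0 <= x then psi_nneg x else - psi_nneg (- x).

Section Estimator.
Context (R : realType) (d n : nat).

(* log(1/eps) + 0.73 (d + 1) *)
Definition log_term (eps : R) : R := ln eps^-1 + 73 / 100 * (d.+1)%:R.

Definition lambda (kappa eps : R) : R :=
  Num.sqrt (2 / ((kappa + 2 * Num.sqrt kappa) * n%:R) * log_term eps).

Definition Nhat (kappa eps : R) (x : 'I_n -> 'rV[R]_d) (theta : 'rV[R]_d) :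
    \bar R :=
  ereal_inf [set ereal_inf [set rho%:E | rho in [set rho : R |
      0 < rho /\
      \sum_(i < n) psi (lambda kappa eps *
                        ((dot theta (x i) - xi) ^+ 2 / rho - 1)) <= 0]]
    | xi in [set: R]].

Definition mu (kappa eps : R) : R :=
  Num.sqrt (2 * (kappa + 2 * Num.sqrt kappa) / n%:R * log_term eps) +
  681 / 100 * (Num.sqrt kappa + 1) * Num.sqrt (2 * (d.+1)%:R / n%:R).

Definition sample_size_bound (kappa eps : R) : R :=
  (20 * (Num.sqrt kappa + 1) * Num.sqrt (d.+1)%:R +
   (5 / 2 + 1 / (2 * (kappa + 2 * Num.sqrt kappa))) *
     Num.sqrt (2 * (kappa + 2 * Num.sqrt kappa) * log_term eps)) ^+ 2.

End Estimator.

(* Quotient with 0/0 = 1 and z/0 = +oo for z > 0; the library's extended-real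
   division already has z / 0 = +oo for z > 0, but 0 / 0 = 0. *)
Definition ediv (R : realType) (x y : \bar R) : \bar R :=
  if (x == 0%E) && (y == 0%E) then 1%E else (x / y)%E.

(* Main.v *)
Require Import Defs.
From mathcomp Require Import all_boot all_order all_algebra.
From mathcomp Require Import all_classical all_reals all_analysis.
From mathcomp Require Import measurable_realfun ring lra.

Import Order.TTheory GRing.Theory Num.Theory.
Import numFieldNormedType.Exports.

Local Open Scope classical_set_scope.
Local Open Scope ring_scope.

(** The estimator solves sum_i psi (lam * ((<theta, X_i> - xi)^2 / rho - 1)) <= 0
    for rho, and the left-hand side is monotone in rho.  Everything therefore
    reduces to the sign of that sum at two scales: with eta = mu / (1 - 2 mu), it
    must be nonpositive at rho = N / (1 - eta) for the best shift xi, and positive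
    at rho = (N + shift^2) / (1 + eta) for every shift, where N is the variance in
    the direction theta.  Both signs have to hold for all theta and xi at once.

    For one direction this is a Chernoff bound: exp (psi x) <= 1 + x + x^2 / 2, and
    the kurtosis assumption bounds the mean of the right-hand side.  It produces
    the first square root in mu, with its exact constant, because lam is the
    optimal exponent.

    Uniformity comes from a PAC-Bayes argument whose posteriors are discrete.
    Whiten the augmented vector (X - E X, 1), so that a pair (theta, xi) becomes a
    coefficient vector v in dimension D = d + 1, and round v at random to a point g
    of the lattice sigma Z^D: each coordinate moves independently to one of its two
    lattice neighbours, with mean v ([rounding]).  Taking two independent roundings
    g, g' makes <g, x> <g', x> an unbiased estimate of <v, x>^2, with no correction
    term.  The function ln (1 + x + x^2 / 2) is convex up to x^2
    ([ln_quad_paraboloid]), so psi of the mean is at most the mean of ln (1 + H +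
    H^2 / 2) plus a variance; since psi is bounded, that variance may be truncated,
    and the truncated term is again dominated by an average over g
    ([saturate_mean]).  What is left is an average over pairs of lattice points of
    functions with a controlled exponential moment, so one Markov inequality with
    product geometric weights on the lattice covers all of them
    ([weighted_union_bound]).  The weights cost a multiple of D and the variance
    costs n lam^2 kp delta and n lam^2 kp delta^2, where kp is the kurtosis of the
    augmented vector and delta = D sigma^2 / 4 is the total rounding variance.
    Choosing delta of order 1 / (lam sqrt (n kp / D)) keeps the sum of these under
    0.73 D plus n lam Tm times the second square root in mu, where Tm >= 1 bounds
    the second moment of the forms considered ([entropy_budget],
    [uniform_deviation]).

    The remaining steps are algebraic.  Appending the constant coordinate turns the
    kurtosis kappa into at most (sqrt kappa + 1)^2 = kappa + 2 sqrt kappa + 1 when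
    kappa >= 1 ([Ex_shift4_le]); when kappa < 1 all variances vanish and X is almost
    surely constant.  Directions of zero variance are handled by an almost sure
    event, on which the estimator is 0.  The sample size condition is what makes the
    two signs come out right with eta = mu / (1 - 2 mu) ([lower_budget_lt0],
    [upper_budget_le0]). *)

(** * The influence function and its semi-convex majorant *)

Section InfluenceFunction.
Context {R : realType}.
Implicit Types (x y m a b : R).

Definition quad y : R := 1 + y + y ^+ 2 / 2.

(** The cap 3 exceeds 2 e^(1/4), an upper bound for exp (psi m + p x - x^2) over
    slopes |p| <= 1; with it, [psi_paraboloid] keeps a bounded right-hand side. *)
Definition trunc_quad y : R := Num.min (quad y) 3.

Lemma quad_ge_half y : 1 / 2 <= quad y.
Proof. by rewrite /quad; have := sqr_ge0 (y + 1); nra. Qed.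

Lemma quad_gt0 y : 0 < quad y.
Proof. by have := quad_ge_half y; lra. Qed.

Lemma trunc_quad_ge_half y : 1 / 2 <= trunc_quad y.
Proof. by rewrite /trunc_quad le_min quad_ge_half /=; lra. Qed.

Lemma trunc_quad_gt0 y : 0 < trunc_quad y.
Proof. by have := trunc_quad_ge_half y; lra. Qed.

Lemma ln_ge1Vx x : 0 < x -> 1 - x^-1 <= ln x.
Proof.
move=> x0; have ix0 : 0 < x^-1 by rewrite invr_gt0.
have := @le_ln1Dx R (x^-1 - 1).
by rewrite (_ : 1 + (x^-1 - 1) = x^-1) ?lnV ?posrE//; lra.
Qed.

Lemma psi0 : psi (0 : R) = 0.
Proof. by rewrite /psi lexx ler10 subr0 expr0n /= mul0r addr0 ln1 oppr0. Qed.

Lemma psi_odd x : psi (- x) = - psi x.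
Proof.
have [->|xN0] := eqVneq x 0; first by rewrite oppr0 psi0 oppr0.
rewrite /psi opprK oppr_ge0.
by case: (ltrgtP x 0) xN0 => [x0|x0|->] //=; rewrite ?opprK// eqxx.
Qed.

Lemma psi_le_ln2 x : psi x <= ln 2.
Proof.
have l2 : 0 < ln (2 : R) by rewrite ln_gt0//; lra.
rewrite /psi; case: ifPn => x0.
  case: ifPn => // x1'; have x1 : x < 1 by rewrite ltNge.
  rewrite -lnV ?posrE; last nra.
  rewrite ler_ln ?posrE ?invr_gt0; [|nra|lra].
  by rewrite -[leRHS]invrK lef_pV2 ?posrE; nra.
case: ifPn => x1; first lra.
by rewrite opprK; apply: (le_trans (ln_le0 _)); nra.
Qed.

Lemma psi_le_ln_quad x : psi x <= ln (quad x).
Proof.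
rewrite /psi; case: ifPn => x0.
  case: ifPn => x1.
    by rewrite ler_ln ?posrE ?quad_gt0 /quad//; nra.
  have x1' : x < 1 by rewrite ltNge.
  have p : 0 < 1 - x + x ^+ 2 / 2 by nra.
  rewrite -lnV ?posrE// ler_ln ?posrE ?invr_gt0 ?quad_gt0//.
  rewrite -[leLHS]mul1r ler_pdivrMr// /quad.
  suff : 0 <= x ^+ 4 by nra.
  exact: exprn_even_ge0.
case: ifPn => x1.
  by rewrite -lnV ?posrE// ler_ln ?posrE ?invr_gt0 ?quad_gt0//;
     have := quad_ge_half x; lra.
by rewrite opprK /quad opprK sqrrN.
Qed.

(** Derivative of ln (quad m). *)
Definition quad_slope m : R := (1 + m) / quad m.

Lemma quad_slope_sqr_le1 m : quad_slope m ^+ 2 <= 1.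
Proof.
rewrite /quad_slope expr_div_n ler_pdivrMr ?exprn_gt0 ?quad_gt0// mul1r.
rewrite /quad; have := sqr_ge0 (m + m ^+ 2 / 2); nra.
Qed.

(** A second-order lower bound by a parabola of fixed curvature, which is what
    Jensen's inequality needs when the function is only semi-convex.  It follows
    from ln z >= 1 - 1/z at z = quad y / quad m: after subtraction of the tangent,
    (y - m)^2 factors out, with a coefficient bounded below. *)
Lemma ln_quad_paraboloid m y :
  ln (quad m) + quad_slope m * (y - m) - (y - m) ^+ 2 <= ln (quad y).
Proof.
have qm := quad_gt0 m; have qy := quad_gt0 y.
have := @ln_ge1Vx (quad y / quad m); rewrite divr_gt0// => /(_ isT).
rewrite ln_div ?posrE// invf_div => h.
suff : quad_slope m * (y - m) - (y - m) ^+ 2 <= 1 - quad m / quad y by lra.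
rewrite -subr_ge0.
(* With a = 1 + m and c = 1 + y, the remainder is governed by
   (a^2 + 1) (c^2 + 1) - (a^2 + 2 a c - 1), and 2 a c <= a^2 c^2 + 1. *)
have -> : 1 - quad m / quad y - (quad_slope m * (y - m) - (y - m) ^+ 2) =
  (y - m) ^+ 2 * ((quad m * quad y *+ 4 -
     ((1 + m) ^+ 2 + 2 * (1 + m) * (1 + y) - 1)) / (quad m * quad y *+ 4)).
  rewrite /quad_slope /quad; field; rewrite -/(quad y) -/(quad m).
  by apply/andP; split; rewrite gt_eqF//; nra.
apply: mulr_ge0; first exact: sqr_ge0.
apply: divr_ge0; last by rewrite mulrn_wge0// mulr_ge0 ?ltW.
rewrite /quad subr_ge0.
have := sqr_ge0 ((1 + m) * (1 + y) - 1).
have := sqr_ge0 (1 + y).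
have := sqr_ge0 (1 + m). nra.
Qed.

Lemma ln2_le : ln (2 : R) <= 3 / 4.
Proof.
rewrite -[leRHS]expRK ler_ln ?posrE ?expR_gt0//.
rewrite (_ : 3 / 4 = 6%:R * (1 / 8) :> R); last by field.
rewrite expRM_natl.
apply: (@le_trans _ _ ((9 / 8) ^+ 6)); first lra.
rewrite lerXn2r ?nnegrE ?expR_ge0//.
by have := @expR_ge1Dx R (1 / 8); lra.
Qed.

Lemma ln_3half_ge : 1 / 4 <= ln (3 / 2 : R).
Proof.
have := ln_ge1Vx (3 / 2); rewrite invf_div; lra.
Qed.

(** Since psi <= ln 2 and slopes are at most 1, the parabola peaks below
    ln 2 + 1/4 < ln 3, so it stays under the truncated function as well. *)
Lemma psi_paraboloid m y :
  psi m + quad_slope m * (y - m) - (y - m) ^+ 2 <= ln (trunc_quad y).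
Proof.
rewrite /trunc_quad /Num.min; case: ifPn => _.
  by have := ln_quad_paraboloid m y; have := psi_le_ln_quad m; lra.
have := quad_slope_sqr_le1 m; have := psi_le_ln2 m.
have := ln_3half_ge.
have -> : ln (3 : R) = ln 2 + ln (3 / 2).
  rewrite -lnM ?posrE; [|lra|lra].
  by congr ln; field.
have := sqr_ge0 (quad_slope m / 2 - (y - m)); nra.
Qed.

Lemma psi_nondecreasing x y : x <= y -> psi x <= psi y.
Proof.
have nneg a b : 0 <= a -> a <= b -> psi a <= psi b.
  move=> a0 ab; rewrite /psi a0 (le_trans a0 ab).
  have b0 := le_trans a0 ab.
  case: (leP 1 a) => a1; first by rewrite (le_trans a1 ab).
  have pa : 0 < 1 - a + a ^+ 2 / 2 by nra.
  case: (leP 1 b) => b1.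
    rewrite -lnV ?posrE// ler_ln ?posrE ?invr_gt0//.
    by rewrite -[leRHS]invrK lef_pV2 ?posrE; nra.
  have pb : 0 < 1 - b + b ^+ 2 / 2 by nra.
  by rewrite lerN2 ler_ln ?posrE//; nra.
move=> xy; have [x0|x0] := leP 0 x; first exact: nneg.
have [y0|y0] := leP 0 y; last first.
  by rewrite -lerN2 -!psi_odd; apply: nneg; lra.
apply: (@le_trans _ _ (psi 0)); last exact: nneg.
by rewrite -lerN2 -!psi_odd oppr0; apply: nneg; lra.
Qed.

Lemma psi_le0 x : x <= 0 -> psi x <= 0.
Proof.
by move=> /psi_nondecreasing; rewrite psi0.
Qed.

(** Jensen's inequality with a variance correction.  The correction may be replaced
    by the constant 3/2 >= 2 ln 2 because psi <= ln 2 while the truncated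
    logarithm is at least - ln 2; without this, exponential moments would involve
    the unbounded variance. *)
Lemma mean_convex {I : finType} (q H : I -> R) :
  \sum_i q i = 1 -> (forall i, 0 <= q i) ->
  forall M, \sum_i q i * H i = M ->
  psi M - \sum_i q i * ln (trunc_quad (H i)) <=
  Num.min (3 / 2) (\sum_i q i * (H i - M) ^+ 2).
Proof.
move=> q1 q0 M qM; rewrite le_min; apply/andP; split.
  have : \sum_i q i * - ln 2 <= \sum_i q i * ln (trunc_quad (H i)).
    apply: ler_sum => i _; apply: ler_wpM2l => //.
    rewrite -lnV ?posrE; last lra.
    rewrite ler_ln ?posrE ?trunc_quad_gt0 ?invr_gt0//.
    by have := trunc_quad_ge_half (H i); lra.
  rewrite -mulr_suml q1 mul1r.
  have := psi_le_ln2 M; have := ln2_le; lra.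
have : \sum_i q i * (psi M + quad_slope M * (H i - M) - (H i - M) ^+ 2) <=
       \sum_i q i * ln (trunc_quad (H i)).
  by apply: ler_sum => i _; apply: ler_wpM2l => //; exact: psi_paraboloid.
rewrite (eq_bigr (fun i => psi M * q i + quad_slope M * (q i * H i) -
  quad_slope M * M * q i - q i * (H i - M) ^+ 2)); last by move=> i _; ring.
rewrite !sumrB !big_split /= -!mulr_sumr q1 qM; lra.
Qed.

End InfluenceFunction.

(** * A saturating function compatible with averaging *)

Section Saturation.
Context {R : realType}.
Implicit Types (x y a b : R).

(** A bounded substitute for min (1, x) that is smooth in y when x = a y^2 + b. *)
Definition saturate x : R := x / (1 + x).

Lemma saturate_ge0 x : 0 <= x -> 0 <= saturate x.
Proof. by move=> x0; rewrite divr_ge0//; lra. Qed.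

Lemma saturate_le1 x : 0 <= x -> saturate x <= 1.
Proof. by move=> x0; rewrite ler_pdivrMr; lra. Qed.

Lemma saturate_le x : 0 <= x -> saturate x <= x.
Proof. by move=> x0; rewrite ler_pdivrMr; nra. Qed.

Lemma saturate_homo x y : 0 <= x -> x <= y -> saturate x <= saturate y.
Proof.
move=> x0 xy; have hx : 0 < 1 + x by lra.
have hy : 0 < 1 + y by lra.
by rewrite /saturate ler_pdivrMr// mulrAC ler_pdivlMr//; lra.
Qed.

Lemma min_le_saturate x : 0 <= x -> Num.min (3 / 2) x <= 5 / 2 * saturate x.
Proof.
move=> x0; rewrite /saturate mulrA ler_pdivlMr; last lra.
by rewrite /Num.min; case: ltP => ?; nra.
Qed.

(** Semi-convexity of y |-> saturate (a y^2 + b) with curvature a / (1 + b)^2.  The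
    offset b makes the curvature small relative to the minimum b / (1 + b) of the
    function, which [saturate_mean] exploits. *)
Lemma saturate_paraboloid a b y y' : 0 <= a -> 0 <= b ->
  saturate (a * y ^+ 2 + b) +
    2 * a * y / (1 + b + a * y ^+ 2) ^+ 2 * (y' - y) -
    a / (1 + b) ^+ 2 * (y' - y) ^+ 2 <=
  saturate (a * y' ^+ 2 + b).
Proof.
move=> a0 b0.
have y20 := sqr_ge0 y; have y20' := sqr_ge0 y'.
have A1 : 0 <= a * y ^+ 2 by apply: mulr_ge0.
have A2 : 0 <= a * y' ^+ 2 by apply: mulr_ge0.
pose B := 1 + b; pose P := B + a * y ^+ 2; pose P' := B + a * y' ^+ 2.
have B0 : 0 < B by rewrite /B; lra.
have P0 : 0 < P by rewrite /P; lra.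
have P0' : 0 < P' by rewrite /P'; lra.
rewrite -subr_ge0.
have -> : saturate (a * y' ^+ 2 + b) - (saturate (a * y ^+ 2 + b) +
    2 * a * y / (1 + b + a * y ^+ 2) ^+ 2 * (y' - y) -
    a / (1 + b) ^+ 2 * (y' - y) ^+ 2) =
  a * (y' - y) ^+ 2 *
  ((P ^+ 2 * P' - B ^+ 2 * (a * y ^+ 2 + 2 * a * y * y' - B)) /
   (B ^+ 2 * (P ^+ 2 * P'))).
  rewrite /saturate /P /P' /B; field.
  by rewrite !gt_eqF//=; rewrite /P /P' /B in P0 P0' B0 *; lra.
apply: mulr_ge0; first by rewrite mulr_ge0// sqr_ge0.
apply: divr_ge0; last by rewrite !mulr_ge0 ?exprn_ge0 ?ltW.
rewrite subr_ge0.
have -> : P ^+ 2 * P' = B ^+ 3 + B ^+ 2 * (2 * (a * y ^+ 2) + a * y' ^+ 2) +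
   (B * (a * y ^+ 2) ^+ 2 + 2 * B * (a * y ^+ 2) * (a * y' ^+ 2) +
   (a * y ^+ 2) ^+ 2 * (a * y' ^+ 2)) by rewrite /P /P'; ring.
apply: (@le_trans _ _ (B ^+ 2 * (2 * (a * y ^+ 2) + a * y' ^+ 2))).
  apply: ler_wpM2l; first exact: sqr_ge0.
  have := mulr_ge0 a0 (sqr_ge0 (y - y')); nra.
rewrite -addrA addrCA ler_wpDr// addr_ge0//; first by rewrite exprn_ge0// ltW.
rewrite addr_ge0//; last by rewrite mulr_ge0 ?sqr_ge0.
have hB := ltW B0.
apply: addr_ge0; first exact: mulr_ge0 hB (sqr_ge0 _).
by do 3?[apply: mulr_ge0 => //].
Qed.

(** The variance penalty at the centre y is at most 6/5 of its average over the
    noise: the loss in Jensen's inequality, a S / (1 + b)^2, is at most a fifth of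
    b / (1 + b), itself a lower bound for every term of the average. *)
Lemma saturate_mean {I : finType} (q Y : I -> R) a b y :
  0 <= a -> 0 <= b ->
  \sum_i q i = 1 -> (forall i, 0 <= q i) -> \sum_i q i * Y i = y ->
  5 * a * (\sum_i q i * (Y i - y) ^+ 2) <= b ->
  5 * saturate (a * y ^+ 2 + b) <=
  6 * \sum_i q i * saturate (a * Y i ^+ 2 + b).
Proof.
move=> a0 b0 q1 q0 qY hS; set S := \sum_i q i * (Y i - y) ^+ 2 in hS.
set c := 2 * a * y / (1 + b + a * y ^+ 2) ^+ 2.
have h1 : saturate (a * y ^+ 2 + b) - a / (1 + b) ^+ 2 * S <=
    \sum_i q i * saturate (a * Y i ^+ 2 + b).
  apply: le_trans (_ : _ <= \sum_i q i * (saturate (a * y ^+ 2 + b) +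
    c * (Y i - y) - a / (1 + b) ^+ 2 * (Y i - y) ^+ 2)) _; last first.
    by apply: ler_sum => i _; apply: ler_wpM2l => //; exact: saturate_paraboloid.
  rewrite le_eqVlt; apply/orP; left; apply/eqP.
  rewrite [in RHS](eq_bigr (fun i => saturate (a * y ^+ 2 + b) * q i +
    c * (q i * Y i) - c * y * q i -
    a / (1 + b) ^+ 2 * (q i * (Y i - y) ^+ 2))); last by move=> i _; ring.
  by rewrite !sumrB !big_split /= -!mulr_sumr q1 -/S qY; ring.
have h2 : saturate b <= \sum_i q i * saturate (a * Y i ^+ 2 + b).
  rewrite -[leLHS]mul1r -q1 mulr_suml; apply: ler_sum => i _.
  apply: ler_wpM2l => //; apply: saturate_homo => //.
  by rewrite lerDr mulr_ge0 ?sqr_ge0.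
suff : a / (1 + b) ^+ 2 * S <= saturate b / 5 by lra.
rewrite /saturate mulrAC ler_pdivrMr ?exprn_gt0//; last lra.
rewrite (_ : b / (1 + b) / 5 * (1 + b) ^+ 2 = b * (1 + b) / 5); first by nra.
by field; rewrite gt_eqF//; lra.
Qed.

Lemma expR3_le : expR (3 : R) <= 27.
Proof.
have h : expR (1 : R) <= 3.
  have : (7 / 8) ^+ 8 <= expR (- (1 : R)).
    rewrite (_ : -1 = 8%:R * (- (1 / 8)) :> R); last by field.
    rewrite expRM_natl lerXn2r ?nnegrE ?expR_ge0//.
    by have := @expR_ge1Dx R (- (1 / 8)); lra.
  rewrite expRN => h1.
  rewrite -[leLHS]invrK -[leRHS]invrK lef_pV2 ?posrE ?invr_gt0 ?expR_gt0//; lra.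
rewrite -[X in expR X](mulr1 3%:R) expRM_natl.
apply: (@le_trans _ _ (3 ^+ 3)); last lra.
by rewrite lerXn2r ?nnegrE ?expR_ge0.
Qed.

(** Convexity of exp on [0, 3] together with e^3 <= 27. *)
Lemma expR_saturate_le x : 0 <= x -> expR (3 * saturate x) <= 1 + 26 * x.
Proof.
move=> x0; have s0 := saturate_ge0 _ x0; have s1 := saturate_le1 _ x0.
have : expR (3 * saturate x) <= 1 + 26 * saturate x; last first.
  by have := saturate_le _ x0; lra.
have s01 : (0 <= saturate x <= 1)%R by rewrite s0 s1.
have := @convex_expR R (Itv01 s0 s1) 3 0.
rewrite !convRE /=; have  := expR3_le; rewrite expR0 => h3.
rewrite mulr0 mulr1 => h; move: h; rewrite ?add0r ?addr0 [X in expR X]mulrC /unstable.onem; nra.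
Qed.

(** The truncation at 3 is what allows the penalty to leave the product: it
    contributes 3 * 26 * G instead of G times an unbounded quadratic in H. *)
Lemma expR_summand_le (H G : R) : 0 <= G ->
  expR (ln (trunc_quad H) + 3 * saturate G) <= 1 + H + H ^+ 2 / 2 + 78 * G.
Proof.
move=> G0; rewrite expRD lnK ?posrE ?trunc_quad_gt0//.
have := expR_saturate_le _ G0; have := trunc_quad_gt0 H.
have h3 : trunc_quad H <= 3 by rewrite /trunc_quad ge_min lexx orbT.
have hq : trunc_quad H <= quad H by rewrite /trunc_quad ge_min lexx.
rewrite -/(quad H); nra.
Qed.

End Saturation.

(** * Randomized rounding to a lattice *)

Section BernoulliProduct.
Context {R : realType} {I : finType}.
Variable (p : I -> R).

Definition bits_weight (b : {ffun I -> bool}) : R :=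
  \prod_j (if b j then p j else 1 - p j).

(** Independence of the coordinates of a product Bernoulli vector. *)
Lemma bits_mean_prod (f : I -> bool -> R) :
  \sum_b bits_weight b * \prod_j f j (b j) =
  \prod_j (p j * f j true + (1 - p j) * f j false).
Proof.
rewrite (eq_bigr (fun j => \sum_(c : bool) (if c then p j else 1 - p j) * f j c)).
  by rewrite bigA_distr_bigA; apply: eq_bigr => b _; rewrite big_split.
by move=> j _; rewrite big_bool.
Qed.

Lemma bits_weight_sum : \sum_b bits_weight b = 1.
Proof.
transitivity (\sum_b bits_weight b * \prod_(j : I) (fun _ _ => 1 : R) j (b j)).
  by apply: eq_bigr => b _; rewrite big1 ?mulr1.
by rewrite (bits_mean_prod (fun _ _ => 1)) big1// => j _; rewrite !mulr1 addrC subrK.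
Qed.

Lemma bits_weight_ge0 b : (forall j, 0 <= p j <= 1) -> 0 <= bits_weight b.
Proof.
by move=> hp; apply: prodr_ge0 => j _; have := hp j; case: (b j); lra.
Qed.

Let e (b : {ffun I -> bool}) (j : I) : R := (b j)%:R - p j.

Lemma bits_mean i : \sum_b bits_weight b * e b i = 0.
Proof.
pose f (j : I) (c : bool) : R := if j == i then c%:R - p j else 1.
transitivity (\sum_b bits_weight b * \prod_j f j (b j)).
  apply: eq_bigr => b _; congr (_ * _).
  by rewrite (bigD1 i)//= big1 ?mulr1 /f ?eqxx// => j /negbTE ->.
by rewrite bits_mean_prod (bigD1 i)//= /f eqxx /=; ring.
Qed.

Lemma bits_cov i j :
  \sum_b bits_weight b * (e b i * e b j) =
  if i == j then p i * (1 - p i) else 0.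
Proof.
pose g (k l : I) (c : bool) : R := if l == k then c%:R - p l else 1.
have ge k (b : {ffun I -> bool}) : \prod_l g k l (b l) = e b k.
  by rewrite (bigD1 k)//= big1 ?mulr1 /g ?eqxx// => l /negbTE ->.
transitivity (\sum_b bits_weight b * \prod_l (g i l (b l) * g j l (b l))).
  by apply: eq_bigr => b _; rewrite big_split /= !ge.
rewrite (bits_mean_prod (fun l c => g i l c * g j l c)) (bigD1 i)//= /g eqxx.
have [ij|ij] := eqVneq i j; last by rewrite !mulr1 /=; ring.
rewrite big1 => [|l li]; first by rewrite /=; ring.
by rewrite -ij (negbTE li); ring.
Qed.

Lemma bits_variance (x : I -> R) :
  \sum_b bits_weight b * (\sum_j e b j * x j) ^+ 2 =
  \sum_j p j * (1 - p j) * x j ^+ 2.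
Proof.
transitivity (\sum_i \sum_j x i * x j * \sum_b bits_weight b * (e b i * e b j)).
  transitivity (\sum_b \sum_i \sum_j x i * x j * (bits_weight b * (e b i * e b j))).
    apply: eq_bigr => b _; rewrite expr2 big_distrlr /= mulr_sumr.
    by apply: eq_bigr => i _; rewrite mulr_sumr; apply: eq_bigr => j _; ring.
  rewrite exchange_big; apply: eq_bigr => i _.
  by rewrite exchange_big; apply: eq_bigr => j _; rewrite mulr_sumr.
apply: eq_bigr => i _; rewrite (bigD1 i)//= bits_cov eqxx big1 ?addr0.
  by ring.
by move=> j ji; rewrite bits_cov eq_sym (negbTE ji) mulr0.
Qed.

End BernoulliProduct.

Section RandomizedRounding.
Context {R : realType} {I : finType}.

Definition grid (N : nat) := {ffun I -> 'I_N.*2.+1}.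

(** Lattice coordinates are stored as naturals shifted by N. *)
Definition node {N} (g : grid N) (j : I) : R := (g j)%:R - N%:R.

(** The posterior is the law of the random rounding, pushed forward to the finite
    grid.  Each coordinate of v / sigma moves to its floor plus a Bernoulli bit whose
    mean is the fractional part p, so the variance per coordinate is
    p (1 - p) <= 1/4. *)
Lemma rounding (sigma : R) (N : nat) (v : I -> R) : 0 < sigma ->
  (forall j, `|v j| / sigma + 2 <= N%:R) ->
  exists q : grid N -> R,
    [/\ forall g, 0 <= q g,
        \sum_g q g = 1,
        forall x : I -> R,
          \sum_g q g * (\sum_j sigma * node g j * x j) = \sum_j v j * x j,
        forall x : I -> R,
          \sum_g q g * (\sum_j sigma * node g j * x j - \sum_j v j * x j) ^+ 2
            <= sigma ^+ 2 / 4 * \sum_j x j ^+ 2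
      & \sum_g q g * (\sum_j node g j ^+ 2)
            <= (\sum_j v j ^+ 2) / sigma ^+ 2 + #|I|%:R / 4].
Proof.
move=> s0 hN.
pose k j : int := Num.floor (v j / sigma).
pose p j : R := v j / sigma - (k j)%:~R.
have hk j : (k j)%:~R <= v j / sigma < (k j)%:~R + 1.
  by have := floor_itv (v j / sigma); rewrite intrD.
have p01 j : 0 <= p j <= 1 by have := hk j; rewrite /p; lra.
(* The margin 2 in the hypothesis on N keeps floor + bit inside the grid. *)
pose r (b : {ffun I -> bool}) : grid N :=
  [ffun j => inord (absz (k j + (b j : nat)%:Z + N%:Z))].
have rE b j : node (r b) j = (k j)%:~R + (b j)%:R.
  have hv : `|v j / sigma| + 2 <= N%:R.
    by rewrite normrM [`|sigma^-1|]gtr0_norm ?invr_gt0.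
  have [hv1 hv2] : - (N%:R - 2) <= v j / sigma /\ v j / sigma <= N%:R - 2.
    have : `|v j / sigma| <= N%:R - 2 by lra.
    by rewrite ler_norml => /andP[]; lra.
  have bb : 0 <= ((b j)%:R : R) <= 1 by case: (b j) => /=; lra.
  have k0 : 0 <= k j + (b j : nat)%:Z + N%:Z.
    by rewrite -(ler0z R) !intrD -!pmulrn; have := hk j; lra.
  have kN : (absz (k j + (b j : nat)%:Z + N%:Z)%R < N.*2.+1)%N.
    rewrite ltnS -lez_nat gez0_abs// -(ler_int R) !intrD -!pmulrn.
    by rewrite -addnn natrD; have := hk j; lra.
  rewrite /node ffunE inordK// pmulrn gez0_abs// !intrD -!pmulrn; ring.
pose Q := bits_weight p.
pose q (g : grid N) := \sum_(b | r b == g) Q b.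
have push F : \sum_g q g * F g = \sum_b Q b * F (r b).
  rewrite (partition_big r predT)//=; apply: eq_bigr => g _.
  by rewrite mulr_suml; apply: eq_bigr => b /eqP ->.
have Q1 : \sum_b Q b = 1 by exact: bits_weight_sum.
have Q0 b : 0 <= Q b by exact: bits_weight_ge0.
have vE j : v j = sigma * ((k j)%:~R + p j).
  by rewrite /p; field; rewrite gt_eqF.
have dev b (x : I -> R) : \sum_j sigma * node (r b) j * x j - \sum_j v j * x j =
    sigma * \sum_j ((b j)%:R - p j) * x j.
  rewrite mulr_sumr -sumrB; apply: eq_bigr => j _.
  by rewrite rE [v j]vE; ring.
have pp j : p j * (1 - p j) <= 1 / 4 by have := sqr_ge0 (p j - 1 / 2); nra.
exists q; split.
- by move=> g; apply: sumr_ge0.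
- by rewrite -Q1 (partition_big r predT).
- move=> x; rewrite push.
  transitivity (\sum_b Q b * (\sum_j v j * x j +
     sigma * \sum_j ((b j)%:R - p j) * x j)).
    by apply: eq_bigr => b _; rewrite -dev addrC subrK.
  transitivity (\sum_j v j * x j +
    sigma * \sum_j x j * \sum_b Q b * ((b j)%:R - p j)).
    rewrite (eq_bigr (fun b => (\sum_j v j * x j) * Q b + sigma *
       \sum_j x j * (Q b * ((b j)%:R - p j)))).
      rewrite big_split /= -mulr_sumr Q1 mulr1 -mulr_sumr exchange_big /=.
      by congr (_ + _ * _); apply: eq_bigr => j _; rewrite mulr_sumr.
    move=> b _; rewrite mulrDr mulrC; congr (_ + _).
    by rewrite mulrCA; congr (_ * _); rewrite mulr_sumr; apply: eq_bigr => j _; ring.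
  by rewrite [X in _ + sigma * X]big1 ?mulr0 ?addr0// => j _; rewrite bits_mean mulr0.
- move=> x; rewrite push.
  under eq_bigr do rewrite dev exprMn mulrCA.
  rewrite -mulr_sumr bits_variance -mulrA ler_wpM2l ?sqr_ge0//.
  rewrite mulr_sumr; apply: ler_sum => j _.
  by rewrite ler_wpM2r ?sqr_ge0//; have := pp j; lra.
- rewrite push.
  apply: (@le_trans _ _ (\sum_j ((v j / sigma) ^+ 2 + 1 / 4))); last first.
    rewrite big_split /= sumr_const mulr_suml lerD//.
      by apply: ler_sum => j _; rewrite expr_div_n.
    by rewrite -mulr_natl; lra.
  rewrite (eq_bigr (fun b => \sum_j Q b * node (r b) j ^+ 2)); last first.
    by move=> b _; rewrite mulr_sumr.
  rewrite exchange_big /=; apply: ler_sum => j _.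
  rewrite (eq_bigr (fun b => (v j / sigma) ^+ 2 * Q b +
    2 * (v j / sigma) * (Q b * ((b j)%:R - p j)) +
    Q b * (((b j)%:R - p j) * ((b j)%:R - p j)))); last first.
    by move=> b _; rewrite rE (_ : v j / sigma = (k j)%:~R + p j) /p; ring.
  rewrite !big_split /= -!mulr_sumr Q1 bits_mean bits_cov eqxx.
  by have := pp j; lra.
Qed.

Lemma sum_geom_le (a : R) n : 0 <= a < 1 -> \sum_(i < n) a ^+ i <= (1 - a)^-1.
Proof.
move=> /andP[a0 a1]; have a1' : 0 < 1 - a by lra.
rewrite -[leRHS]mul1r ler_pdivlMr// mulrC.
have := subrX1 a n; have := exprn_ge0 n a0; lra.
Qed.

Lemma sum_two_sided_geom_le (a : R) N : 0 <= a < 1 ->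
  \sum_(i < N.*2.+1) a ^+ ((i - N) + (N - i)) <= (1 + a) / (1 - a).
Proof.
move=> a01; have /andP[a0 a1] := a01.
rewrite -(big_mkord xpredT (fun i => a ^+ ((i - N) + (N - i)))).
have le1 : (N <= N.*2.+1)%N by rewrite -addnn leqW// leq_addr.
rewrite (big_cat_nat _ le1)//= mulrDl mul1r addrC lerD//.
  rewrite -{1}[N]add0n big_addn.
  rewrite (_ : (N.*2.+1 - N = N.+1)%N); last by rewrite -addnn -addSn addnK.
  rewrite big_mkord; apply: le_trans (sum_geom_le _ N.+1 a01).
  apply: ler_sum => i _; rewrite addnK (_ : (N - (i + N) = 0)%N) ?addn0//.
  by apply/eqP; rewrite subn_eq0 leq_addl.
rewrite big_mkord (reindex_inj rev_ord_inj) /=.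
rewrite (eq_bigr (fun i : 'I_N => a * a ^+ i)); last first.
  move=> i _; rewrite -exprS; congr (_ ^+ _).
  rewrite subKn// (_ : (N - i.+1 - N = 0)%N) ?add0n//.
  by apply/eqP; rewrite subn_eq0 leq_subr.
by rewrite -mulr_sumr ler_wpM2l// sum_geom_le.
Qed.

(** Product of two-sided geometric weights with ratio 1 / (1 + eta).  The cost of a
    node k is k ln (1 + eta) <= eta |k| <= 1/2 + eta^2 k^2 / 2, which is quadratic
    and can therefore be averaged over the rounding. *)
Lemma grid_prior N (eta : R) : 0 < eta ->
  exists w : grid N -> R,
    [/\ forall g, 0 < w g, \sum_g w g <= 1 &
      forall g, - ln (w g) <=
        #|I|%:R * (1 / 2 + ln (1 + 2 / eta)) + eta ^+ 2 / 2 * \sum_j node g j ^+ 2].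
Proof.
move=> eta0.
pose a : R := (1 + eta)^-1.
have e1 : 0 < 1 + eta by lra.
have a0 : 0 < a by rewrite invr_gt0.
have a1 : a < 1 by rewrite invf_lt1//; lra.
have z0 : 0 < 1 + 2 / eta by rewrite addr_gt0// divr_gt0.
pose ab (i : nat) := ((i - N) + (N - i))%N.
exists (fun g : grid N => \prod_j (a ^+ ab (g j) / (1 + 2 / eta))); split.
- by move=> g; apply: prodr_gt0 => j _; rewrite divr_gt0// exprn_gt0.
- rewrite -(bigA_distr_bigA (fun (j : I) (i : 'I_N.*2.+1) => a ^+ ab i / (1 + 2 / eta))).
  apply: prodr_ile1 => j _; apply/andP; split.
    by apply: sumr_ge0 => i _; rewrite divr_ge0 ?exprn_ge0 ?ltW.
  rewrite -mulr_suml ler_pdivrMr// mul1r.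
  have := sum_two_sided_geom_le a N; rewrite ltW// a1 => /(_ isT).
  suff -> : (1 + a) / (1 - a) = 1 + 2 / eta by [].
  by rewrite /a; field; rewrite !gt_eqF//; lra.
- move=> g.
  have -> : ln (\prod_j (a ^+ ab (g j) / (1 + 2 / eta))) =
     \sum_j ln (a ^+ ab (g j) / (1 + 2 / eta)).
    suff [] : 0 < \prod_j (a ^+ ab (g j) / (1 + 2 / eta)) /\
      ln (\prod_j (a ^+ ab (g j) / (1 + 2 / eta))) =
      \sum_j ln (a ^+ ab (g j) / (1 + 2 / eta)) by [].
    elim/big_rec2 : _ => [|j y1 y2 _ [y20 <-]]; first by rewrite ln1.
    have ? : 0 < a ^+ ab (g j) / (1 + 2 / eta) by rewrite divr_gt0// exprn_gt0.
    by rewrite mulr_gt0// lnM.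
  have -> : #|I|%:R * (1 / 2 + ln (1 + 2 / eta)) =
      \sum_(j : I) (1 / 2 + ln (1 + 2 / eta)) by rewrite sumr_const mulr_natl.
  rewrite -sumrN mulr_sumr -big_split /=.
  apply: ler_sum => j _.
  rewrite ln_div ?posrE ?exprn_gt0// lnXn// /a lnV// -mulr_natl.
  have hab : ((ab (g j))%:R : R) ^+ 2 = node g j ^+ 2.
    rewrite /node /ab; case: (leqP N (g j)) => h.
      by rewrite natrD natrB// (_ : (N - g j)%N = 0%N) ?addr0//; apply/eqP; rewrite subn_eq0.
    rewrite (_ : (g j - N)%N = 0%N); last by apply/eqP; rewrite subn_eq0 ltnW.
    by rewrite add0n natrB ?(ltnW h)// -sqrrN opprB.
  have l1 : ln (1 + eta) <= eta by apply: le_ln1Dx; lra.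
  rewrite -hab; set c : R := (ab (g j))%:R.
  have c0 : 0 <= c by rewrite ler0n.
  have := sqr_ge0 (c * eta - 1); nra.
Qed.

End RandomizedRounding.

(** * Exponential moments of independent copies *)

Section Independence.
Local Open Scope ereal_scope.
Context {d d' : measure_display} {T : measurableType d} {T' : measurableType d'}.
Context {R : realType}.

Import HBNNSimple.

(** Measure-theoretic induction: an identity known for indicators of Y extends to
    simple functions by linearity and to nonnegative functions by monotone
    convergence.  The weight g carries the factors that are not being extended. *)
Lemma integral_mul_comp (P : {measure set T -> \bar R})
    (m : {measure set T' -> \bar R}) (g : T -> R) (Y : T -> T') (c : \bar R) :
  measurable_fun setT g -> (forall w, 0 <= g w)%R -> measurable_fun setT Y ->
  0 <= c -> c \is a fin_num ->
  (forall B, measurable B -> \int[P]_w (g w * \1_B (Y w))%:E = c * m B) ->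
  forall F : T' -> R, measurable_fun setT F -> (forall y, 0 <= F y)%R ->
  \int[P]_w (g w * F (Y w))%:E = c * \int[m]_y (F y)%:E.
Proof.
move=> mg g0 mY c0 cfin gB F mF F0.
have simple (f : {nnsfun T' >-> R}) :
    \int[P]_w (g w * f (Y w))%:E = c * \int[m]_y (f y)%:E.
  pose B k := f @^-1` [set k].
  have mB k : measurable (B k) by exact: measurable_sfunP.
  have mI k : measurable_fun [set: T'] (\1_(B k) : T' -> R).
    exact: measurable_indic.
  have kI0 k y : (0 <= k * \1_(B k) y)%R.
    have [k0|k0] := ltP k 0%R; last by rewrite mulr_ge0.
    by rewrite /B preimage_nnfun0// indic0 mulr0.
  have fE y : (f y)%:E = \sum_(k \in range f) (k * \1_(B k) y)%:E.
    by rewrite fimfunE -fsumEFin.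
  transitivity (\sum_(k \in range f) k%:E * (c * m (B k))).
    transitivity (\sum_(k \in range f)
        \int[P]_w (k * (g w * \1_(B k) (Y w)))%:E).
      rewrite -ge0_integral_fsum//.
      - apply: eq_integral => w _; rewrite EFinM fE.
        rewrite ge0_mule_fsumr//; last by move=> k; rewrite lee_fin.
        by apply: eq_fsbigr => k _; rewrite -EFinM mulrCA.
      - move=> k; apply/measurable_EFinP/measurable_funM => //.
        by apply: measurable_funM => //; exact: measurableT_comp (mI k) mY.
      - by move=> k w _; rewrite lee_fin mulrCA mulr_ge0.
    apply: eq_fsbigr => k _.
    have [k0|k0] := ltP k 0%R.
      rewrite /B preimage_nnfun0// measure0 !mule0.
      by under eq_integral do rewrite indic0 !mulr0; rewrite integral0.
    under eq_integral do rewrite EFinM.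
    rewrite ge0_integralZl_EFin// ?gB//.
    - by move=> w _; rewrite lee_fin mulr_ge0.
    - apply/measurable_EFinP; apply: measurable_funM => //.
      exact: measurableT_comp (mI k) mY.
  transitivity (c * \sum_(k \in range f) k%:E * m (B k)).
    rewrite ge0_mule_fsumr//; last by move=> k; exact: nnsfun_mulemu_ge0.
    by apply: eq_fsbigr => k _; rewrite muleCA.
  congr (_ * _); under eq_integral do rewrite fE.
  rewrite ge0_integral_fsum//.
  - apply: eq_fsbigr => k _; rewrite integralZl_indic_nnsfun//.
    by rewrite integral_indic// setIT.
  - by move=> k; apply/measurable_EFinP/measurable_funM.
  - by move=> k y _; rewrite lee_fin.
have mEF : measurable_fun setT (EFin \o F) by exact/measurable_EFinP.
have EF0 : forall y, [set: T'] y -> 0 <= (EFin \o F) y.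
  by move=> y _; rewrite lee_fin.
pose f := nnsfun_approx measurableT mEF.
have nd y : nondecreasing_seq (fun n => f n y).
  by move=> a b ab; have /lefP := nd_nnsfun_approx measurableT mEF ab; exact.
have fF y : EFin \o f ^~ y @ \oo --> (F y)%:E.
  exact: (cvg_nnsfun_approx measurableT mEF EF0).
have limF y : limn (fun n => (f n y)%:E) = (F y)%:E by exact/cvg_lim/fF.
have h1 : \int[P]_w (g w * f n (Y w))%:E @[n --> \oo] --> \int[P]_w (g w * F (Y w))%:E.
  have -> : \int[P]_w (g w * F (Y w))%:E =
      \int[P]_w limn (fun n => (g w * f n (Y w))%:E).
    apply: eq_integral => w _; apply/esym/cvg_lim => //.
    under eq_fun do rewrite EFinM.
    by rewrite EFinM; apply: cvgeZl => //; exact: fF.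
  apply: cvg_monotone_convergence => //.
  - move=> n; apply/measurable_EFinP/measurable_funM => //.
    exact: measurableT_comp.
  - by move=> n w _; rewrite lee_fin mulr_ge0.
  - by move=> w _ a b ab; rewrite lee_fin ler_wpM2l//; exact: nd.
have h2 : \int[m]_y (f n y)%:E @[n --> \oo] --> \int[m]_y (F y)%:E.
  under [X in _ --> X]eq_integral do rewrite -limF.
  apply: cvg_monotone_convergence => //.
  - by move=> n; apply/measurable_EFinP.
  - by move=> n w _; rewrite lee_fin.
  - by move=> w _ a b ab; rewrite lee_fin; exact: nd.
have h3 := cvgeZl cfin h2.
have E : (fun n => \int[P]_w (g w * f n (Y w))%:E) =
    (fun n => c * \int[m]_y (f n y)%:E) by apply/funext => n; exact: simple.
by rewrite E in h1; exact: (cvg_unique _ h1 h3).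
Qed.

(** Independence is a statement about events, so the indicators are replaced by F
    one index at a time. *)
Lemma independent_prod_integral (P : probability T R) (n : nat)
    (Y : 'I_n -> {RV P >-> T'}) (X : {RV P >-> T'}) :
  independent_copies Y X ->
  forall F : T' -> R, measurable_fun setT F -> (forall y, 0 <= F y)%R ->
  \int[P]_w (F (X w))%:E < +oo ->
  \int[P]_w (\prod_i F (Y i w))%:E = (\int[P]_w (F (X w))%:E) ^+ n.
Proof.
move=> [indep ident] F mF F0 Ffin.
set a := \int[P]_w (F (X w))%:E.
have a0 : 0 <= a by apply: integral_ge0 => w _; rewrite lee_fin.
have afin : a \is a fin_num by rewrite ge0_fin_numE.
have aE i : \int[distribution P (Y i)]_y (F y)%:E = a.
  rewrite (eq_measure_integral (distribution P X)); last first.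
    by move=> B mB _; exact: ident.
  by rewrite ge0_integral_distribution//; exact/measurable_EFinP.
pose h (s : seq 'I_n) (B : 'I_n -> set T') i y : R :=
  if i \in s then F y else \1_(B i) y.
pose l (s : seq 'I_n) (B : 'I_n -> set T') i : \bar R :=
  if i \in s then a else P (Y i @^-1` B i).
(* Indices in s already carry F, the others an arbitrary event. *)
have key s : uniq s -> forall B, (forall i, measurable (B i)) ->
    \int[P]_w (\prod_i h s B i (Y i w))%:E = \prod_i l s B i.
  elim: s => [_ B mB|i s IH /= /andP[si us] B mB].
    have := indep [set: 'I_n]%SET B mB.
    rewrite (eq_bigl xpredT) => [<-|i]; last by rewrite inE.
    rewrite -[X in P X]setIT -integral_indic//; last first.
      apply: fin_bigcap_measurable => [|i _]; first exact: finite_finset.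
      exact: measurable_funPTI.
    apply: eq_integral => w _; congr EFin; rewrite indicE.
    case: (boolP (w \in _)) => hw.
      rewrite big1// => i _; rewrite /h /= indicE mem_set//.
      by move: hw; rewrite inE => /(_ i); apply; rewrite /= inE.
    move: hw; rewrite notin_setE => hw.
    have [i hi] : exists i, ~ B i (Y i w).
      apply/not_existsP => hB; apply: hw => i _ /=.
      by apply: contrapT; exact: hB.
    by rewrite (bigD1 i)//= {1}/h /= indicE memNset// mul0r.
  pose g w : R := (\prod_(j | j != i) h (i :: s) B j (Y j w))%R.
  pose c := \prod_(j | j != i) l (i :: s) B j.
  have l0 j : 0 <= l (i :: s) B j by rewrite /l; case: ifP.
  have lfin j : l (i :: s) B j \is a fin_num.
    by rewrite /l; case: ifP => // _; apply: fin_num_measure; exact: measurable_funPTI.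
  have mh t C j : (forall i, measurable (C i)) ->
      measurable_fun setT (h t C j \o Y j).
    move=> mC; apply: measurableT_comp => //.
    by rewrite /h; case: (j \in t) => //; exact: measurable_indic.
  have h0 t C j y : (0 <= h t C j y)%R by rewrite /h; case: ifP.
  rewrite (bigD1 i)//= -/c /l mem_head muleC.
  rewrite -(aE i) -(@integral_mul_comp P _ g (Y i) c)//.
  - apply: eq_integral => w _; congr EFin.
    by rewrite (bigD1 i)//= mulrC; congr (_ * _)%R; rewrite /h mem_head.
  - rewrite /g; under eq_fun do rewrite big_mkcond /=.
    by apply: measurable_prod => j _; case: (j != i) => //; exact: mh.
  - by move=> w; apply: prodr_ge0 => j _; exact: h0.
  - by apply: prode_ge0 => j _; exact: l0.
  - by apply: prode_fin_num => j _; exact: lfin.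
  move=> B' mB'.
  pose C j := if j == i then B' else B j.
  have mC j : measurable (C j) by rewrite /C; case: ifP.
  transitivity (\int[P]_w (\prod_j h s C j (Y j w))%:E).
    apply: eq_integral => w _; congr EFin.
    rewrite [RHS](bigD1 i)//= mulrC /h (negbTE si) /C eqxx; congr (_ * _)%R.
    by apply: eq_bigr => j ji; rewrite /h inE (negbTE ji).
  rewrite IH// (bigD1 i)//= muleC {2}/l (negbTE si) /C eqxx; congr (_ * _).
  by apply: eq_bigr => j ji; rewrite /l inE (negbTE ji).
rewrite (eq_integral (fun w => (\prod_i h (enum 'I_n) (fun=> setT) i (Y i w))%:E)).
  rewrite key ?enum_uniq// (eq_bigr (fun=> a)).
    by rewrite big_const_ord iter_mule mule1.
  by move=> i _; rewrite /l mem_enum.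
by move=> w _; congr EFin; apply: eq_bigr => i _; rewrite /h mem_enum.
Qed.

(** Markov's inequality for the mixture, with weights pi, of the normalised
    exponentials exp (sum_i G k (Y_i) - n Gamma k), each of mean at most 1.  A single
    mixture replaces the union bound and gives all k simultaneously. *)
Lemma weighted_union_bound (P : probability T R) (n : nat)
    (Y : 'I_n -> {RV P >-> T'}) (X : {RV P >-> T'}) (K : finType)
    (pi : K -> R) (G : K -> T' -> R) (Gamma : K -> R) (eps : R) :
  independent_copies Y X ->
  (forall k, 0 < pi k)%R -> (\sum_k pi k <= 1)%R -> (0 < eps)%R ->
  (forall k, measurable_fun setT (G k)) ->
  (forall k, \int[P]_w (expR (G k (X w)))%:E <= (expR (Gamma k))%:E) ->
  exists A : set T, [/\ measurable A, (1 - eps)%:E <= P A &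
    forall w, A w -> forall k,
      (\sum_i G k (Y i w) <= n%:R * Gamma k - ln eps - ln (pi k))%R].
Proof.
move=> XY pi0 pi1 eps0 mG GG.
pose Z k w : R := (pi k * expR (- (n%:R * Gamma k)) *
   \prod_i expR (G k (Y i w)))%R.
have Z0 k w : (0 <= Z k w)%R.
  by rewrite /Z !mulr_ge0 ?expR_ge0 ?(ltW (pi0 k))// prodr_ge0// => i _; rewrite expR_ge0.
have mE k : measurable_fun setT (fun y => expR (G k y)).
  exact: measurableT_comp (mG k).
have mprod k : measurable_fun setT (fun w => \prod_i expR (G k (Y i w)))%R.
  by apply: measurable_prod => i _; exact: measurableT_comp (mE k) _.
have mZ k : measurable_fun setT (Z k).
  by apply: measurable_funM => //; exact: measurable_cst.
have intZ k : \int[P]_w (Z k w)%:E <= (pi k)%:E.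
  under eq_integral do rewrite EFinM.
  rewrite ge0_integralZl_EFin//; last 3 first.
  - by move=> w _; rewrite lee_fin prodr_ge0// => i _; rewrite expR_ge0.
  - exact/measurable_EFinP.
  - by rewrite mulr_ge0 ?expR_ge0 ?(ltW (pi0 k)).
  rewrite (independent_prod_integral P n Y X XY (fun y => expR (G k y)))//; last first.
    by apply: le_lt_trans (GG k) _; rewrite ltry.
  have := GG k; set a := integral _ _ _ => ha.
  have a0 : 0 <= a by apply: integral_ge0 => w _; rewrite lee_fin expR_ge0.
  have afin : a \is a fin_num by rewrite ge0_fin_numE// (le_lt_trans ha)// ltry.
  have /EFin_fin_numP[r ar] := afin.
  move: a0 ha; rewrite ar !lee_fin => r0 hr.
  rewrite -EFin_expe -EFinM lee_fin -mulrA ger_pMr// mulrC.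
  rewrite expRN ler_pdivrMr ?expR_gt0// mul1r expRM_natl.
  by rewrite lerXn2r ?nnegrE ?expR_ge0.
pose S w : R := (\sum_k Z k w)%R.
have mS : measurable_fun setT S by apply: measurable_sum => k; exact: mZ.
have S0 w : (0 <= S w)%R by apply: sumr_ge0.
have intS : \int[P]_w (S w)%:E <= 1.
  rewrite /S; under eq_integral do rewrite -sumEFin.
  rewrite ge0_integral_sum//; last 2 first.
  - by move=> k; exact/measurable_EFinP.
  - by move=> k w _; rewrite lee_fin.
  apply: (@le_trans _ _ (\sum_k (pi k)%:E)); first exact: lee_sum.
  by rewrite sumEFin lee_fin.
pose A := [set w | (S w <= eps^-1)%R].
have mA : measurable A.
  rewrite -[A]setTI.
  by apply: (measurable_fun_le measurableT mS); exact: measurable_cst.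
have mAC : measurable (~` A) by exact: measurableC.
exists A; split => //.
  have hC : P (~` A) <= eps%:E.
    have : \int[P]_(w in ~` A) (eps^-1)%:E <= 1.
      apply: le_trans intS.
      apply: (@le_trans _ _ (\int[P]_(w in ~` A) (S w)%:E)).
        apply: ge0_le_integral => //.
        - by move=> w _; rewrite lee_fin invr_ge0 ltW.
        - by apply/measurable_EFinP; exact: measurable_funTS.
        - by move=> w /= /negP; rewrite -ltNge lee_fin => /ltW.
      apply: ge0_subset_integral => //; first exact/measurable_EFinP.
      by move=> w _; rewrite lee_fin.
    rewrite integral_cst//.
    by rewrite /= lee_pdivrMl// mule1.
  have hA : P A = 1 - P (~` A).
    rewrite -[A in LHS]setCK probability_setC//.
  rewrite hA EFinB leeB//.
move=> w /= Aw k.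
have hZ : (Z k w <= eps^-1)%R.
  apply: le_trans Aw; rewrite /S (bigD1 k)//= lerDl; exact: sumr_ge0.
have hp : (0 < \prod_i expR (G k (Y i w)))%R.
  by apply: prodr_gt0 => i _; exact: expR_gt0.
have : (ln (Z k w) <= ln eps^-1)%R.
  by rewrite ler_ln ?posrE ?invr_gt0// /Z !mulr_gt0 ?expR_gt0.
rewrite /Z lnM ?posrE ?mulr_gt0 ?expR_gt0// lnM ?posrE ?expR_gt0// expRK.
rewrite lnV// -expR_sum expRK; lra.
Qed.

End Independence.

(** * Real-valued expectations *)

Section RealExpectation.
Context {d : measure_display} {T : measurableType d} {R : realType}.
Variable P : probability T R.
Implicit Types (f g : T -> R).

Definition integ f := P.-integrable setT (EFin \o f).
Definition Ex f : R := \int[P]_w f w.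

Lemma integ_le f g : measurable_fun setT f -> integ g ->
  (forall w, `|f w| <= g w) -> integ f.
Proof.
move=> mf ig fg; apply: (le_integrable measurableT _ _ ig).
  exact/measurable_EFinP.
by move=> w _ /=; rewrite lee_fin; apply: le_trans (fg w) (ler_norm _).
Qed.

Lemma integ_cst c : integ (fun=> c).
Proof.
exact: (finite_measure_integrable_cst P c).
Qed.

Lemma integZ c f : integ f -> integ (fun w => c * f w).
Proof. by move=> hf; have := integrableZl measurableT c hf. Qed.

Lemma integD f g : integ f -> integ g -> integ (fun w => f w + g w).
Proof. by move=> hf hg; have := integrableD measurableT hf hg. Qed.

Lemma integ_sum (I : finType) (f : I -> T -> R) :
  (forall i, integ (f i)) -> integ (fun w => \sum_i f i w).
Proof.
move=> hf; rewrite /integ.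
have -> : EFin \o (fun w => \sum_i f i w) = (fun w => \sum_i (EFin \o f i) w)%E.
  by apply/funext => w; rewrite /= sumEFin.
by apply: integrable_sum => // i _; exact: hf.
Qed.

Lemma Ex_cst c : Ex (fun=> c) = c.
Proof. rewrite /Ex Rintegral_cst//.
by have /= -> := @probability_setT _ _ _ P; rewrite mulr1.
Qed.

Lemma ExZ c f : integ f -> Ex (fun w => c * f w) = c * Ex f.
Proof. by move=> hf; exact: RintegralZl. Qed.

Lemma ExD f g : integ f -> integ g -> Ex (fun w => f w + g w) = Ex f + Ex g.
Proof. by move=> hf hg; exact: RintegralD. Qed.

Lemma Ex_sum (I : finType) (f : I -> T -> R) :
  (forall i, integ (f i)) -> Ex (fun w => \sum_i f i w) = \sum_i Ex (f i).
Proof.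
move=> hf.
suff h (s : seq I) : integ (fun w => \sum_(i <- s) f i w) /\
    Ex (fun w => \sum_(i <- s) f i w) = \sum_(i <- s) Ex (f i) by case: (h (index_enum I)).
elim: s => [|i s [h1 h2]].
  rewrite big_nil; under eq_fun do rewrite big_nil.
  by split; [exact: integ_cst | exact: Ex_cst].
rewrite big_cons; under eq_fun do rewrite big_cons.
by split; [exact: integD | rewrite ExD// h2].
Qed.

Lemma le_Ex f g : integ f -> integ g -> (forall w, f w <= g w) -> Ex f <= Ex g.
Proof. by move=> hf hg fg; apply: le_Rintegral. Qed.

Lemma Ex_ge0 f : (forall w, 0 <= f w) -> 0 <= Ex f.
Proof. by move=> f0; exact: Rintegral_ge0. Qed.

Lemma EFin_Ex f : integ f -> (Ex f)%:E = (\int[P]_w (f w)%:E)%E.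
Proof. by move=> hf; rewrite /Ex /Rintegral fineK//; exact: integrable_fin_num. Qed.

End RealExpectation.

(** * Averaging over two independent roundings *)

Section Decoupling.
Context {R : realType} {K : finType}.
Variables (q Y : K -> R) (y s lam sg : R).
Hypothesis q0 : forall k, 0 <= q k.
Hypothesis q1 : \sum_k q k = 1.
Hypothesis qY : \sum_k q k * Y k = y.
Hypothesis qs : \sum_k q k * (Y k - y) ^+ 2 <= s.
Hypothesis sg2 : sg ^+ 2 = 1.

Let S := \sum_k q k * (Y k - y) ^+ 2.

Let S0 : 0 <= S.
Proof. by apply: sumr_ge0 => k _; rewrite mulr_ge0 ?sqr_ge0. Qed.

Let s0 : 0 <= s. Proof. exact: le_trans S0 qs. Qed.

Let H (p : K * K) := sg * lam * (Y p.1 * Y p.2 - 1).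
Let pen k := lam ^+ 2 * (2 * Y k ^+ 2 * s + 10 * s ^+ 2).

Let pair_sum (a b : K -> R) :
  \sum_p a p.1 * b p.2 = (\sum_k a k) * (\sum_k b k).
Proof.
by rewrite big_distrlr /= pair_bigA /=; apply: eq_bigr => -[].
Qed.

Let q2 : \sum_p q p.1 * q p.2 = 1. Proof. by rewrite pair_sum q1 mulr1. Qed.

Let qq0 p : 0 <= q p.1 * q p.2. Proof. exact: mulr_ge0. Qed.

Let qYY : \sum_k q k * Y k ^+ 2 = y ^+ 2 + S.
Proof.
rewrite /S [in RHS](eq_bigr (fun k => q k * Y k ^+ 2 +
  (- (2 * y)) * (q k * Y k) + y ^+ 2 * q k)); last by move=> k _; ring.
by rewrite !big_split /= -!mulr_sumr qY q1; ring.
Qed.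

Let mH : \sum_p q p.1 * q p.2 * H p = sg * lam * (y ^+ 2 - 1).
Proof.
rewrite (eq_bigr (fun p => sg * lam * ((q p.1 * Y p.1) * (q p.2 * Y p.2)) +
  (- (sg * lam)) * (q p.1 * q p.2))); last by move=> p _; rewrite /H; ring.
rewrite big_split /= -!mulr_sumr (pair_sum (fun k => q k * Y k) (fun k => q k * Y k)).
by rewrite qY q2; ring.
Qed.

Let mHH : \sum_p q p.1 * q p.2 * H p ^+ 2 =
  lam ^+ 2 * ((y ^+ 2 + S) ^+ 2 - 2 * y ^+ 2 + 1).
Proof.
rewrite (eq_bigr (fun p => sg ^+ 2 * lam ^+ 2 *
     ((q p.1 * Y p.1 ^+ 2) * (q p.2 * Y p.2 ^+ 2)) +
  (- (2 * (sg ^+ 2 * lam ^+ 2))) * ((q p.1 * Y p.1) * (q p.2 * Y p.2)) +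
  sg ^+ 2 * lam ^+ 2 * (q p.1 * q p.2))); last by move=> p _; rewrite /H; ring.
rewrite !big_split /= -!mulr_sumr (pair_sum (fun k => q k * Y k) (fun k => q k * Y k)).
rewrite (pair_sum (fun k => q k * Y k ^+ 2) (fun k => q k * Y k ^+ 2)).
by rewrite qY q2 qYY sg2; ring.
Qed.

Let marg (f : K -> R) : \sum_p q p.1 * q p.2 * f p.1 = \sum_k q k * f k.
Proof.
rewrite (eq_bigr (fun p => (q p.1 * f p.1) * q p.2)); last by move=> p _; ring.
by rewrite (pair_sum (fun k => q k * f k) q) q1 mulr1.
Qed.

(** With two independent roundings the product Y p.1 * Y p.2 has mean y^2 exactly,
    and its variance 2 y^2 S + S^2 only involves the variance S of one rounding.
    The penalty is put on the first rounding alone; the 10 s^2 in it is the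
    offset required by [saturate_mean]. *)
Lemma psi_le_decoupled :
  psi (sg * lam * (y ^+ 2 - 1)) <=
  \sum_p q p.1 * q p.2 * (ln (trunc_quad (H p)) + 3 * saturate (pen p.1)).
Proof.
have := mean_convex (fun p => q p.1 * q p.2) H q2 qq0 _ mH.
set V := (X in Num.min _ X) => hV.
have VE : V = lam ^+ 2 * (2 * y ^+ 2 * S + S ^+ 2).
  rewrite /V (eq_bigr (fun p => q p.1 * q p.2 * H p ^+ 2 +
    (- (2 * (sg * lam * (y ^+ 2 - 1)))) * (q p.1 * q p.2 * H p) +
    (sg * lam * (y ^+ 2 - 1)) ^+ 2 * (q p.1 * q p.2))); last first.
    by move=> p _; ring.
  rewrite !big_split /= -!mulr_sumr mH mHH q2.
  rewrite (_ : (sg * lam * (y ^+ 2 - 1)) ^+ 2 =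
     sg ^+ 2 * (lam * (y ^+ 2 - 1)) ^+ 2); last by ring.
  rewrite (_ : - (2 * (sg * lam * (y ^+ 2 - 1))) * (sg * lam * (y ^+ 2 - 1)) =
     - 2 * (sg ^+ 2 * (lam * (y ^+ 2 - 1)) ^+ 2)); last by ring.
  by rewrite sg2; ring.
pose a := 2 * lam ^+ 2 * s; pose b := 10 * lam ^+ 2 * s ^+ 2.
have hs : 0 <= s := s0.
have hS : 0 <= S := S0.
have a0 : 0 <= a by apply: mulr_ge0 => //; apply: mulr_ge0 => //; exact: sqr_ge0.
have b0 : 0 <= b by apply: mulr_ge0; [apply: mulr_ge0 => // |]; exact: sqr_ge0.
have y20 := sqr_ge0 y.
have g0 : 0 <= a * y ^+ 2 + b by rewrite addr_ge0// mulr_ge0.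
have VG : V <= a * y ^+ 2 + b.
  rewrite VE /a /b.
  rewrite (_ : 2 * lam ^+ 2 * s * y ^+ 2 + 10 * lam ^+ 2 * s ^+ 2 =
    lam ^+ 2 * (2 * y ^+ 2 * s + 10 * s ^+ 2)); last by ring.
  apply: ler_wpM2l; first exact: sqr_ge0.
  have := qs; rewrite -/S => Ss.
  have : 2 * y ^+ 2 * S <= 2 * y ^+ 2 * s by rewrite ler_wpM2l// mulr_ge0.
  have : S ^+ 2 <= s ^+ 2 by rewrite lerXn2r ?nnegrE.
  have := sqr_ge0 s; lra.
have h1 : Num.min (3 / 2) V <= 5 / 2 * saturate (a * y ^+ 2 + b).
  by apply: le_trans (min_le_saturate _ g0); rewrite le_min !ge_min lexx VG orbT.
have h2 : 5 * saturate (a * y ^+ 2 + b) <=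
    6 * \sum_k q k * saturate (a * Y k ^+ 2 + b).
  apply: saturate_mean => //; rewrite -/S /a /b.
  rewrite (_ : 10 * lam ^+ 2 * s ^+ 2 = 5 * (2 * lam ^+ 2 * s) * s); last by ring.
  rewrite ler_wpM2l//; apply: mulr_ge0 => //; exact: a0.
rewrite [leRHS](eq_bigr (fun p => q p.1 * q p.2 * ln (trunc_quad (H p)) +
   3 * (q p.1 * q p.2 * saturate (pen p.1)))); last by move=> p _; ring.
rewrite big_split /= -mulr_sumr (marg (fun k => saturate (pen k))).
rewrite [X in _ + 3 * X](eq_bigr (fun k => q k * saturate (a * Y k ^+ 2 + b))).
  by move: hV h1 h2; set L := \sum_p _ * ln _; set Q := \sum_k _; lra.
by move=> k _; congr (_ * saturate _); rewrite /pen /a /b; ring.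
Qed.

(** Average over the roundings of the polynomial that bounds the exponential in
    [expR_summand_le]; 157 = 1 + 78 * 2 and 1873 / 2 = 1/2 + 78 * 12. *)
Lemma decoupled_poly_le :
  \sum_p q p.1 * q p.2 * (H p + H p ^+ 2 / 2 + 78 * pen p.1) <=
  sg * lam * (y ^+ 2 - 1) +
  lam ^+ 2 / 2 * (y ^+ 4 - 2 * y ^+ 2 + 1) +
  lam ^+ 2 * (157 * (y ^+ 2 * s) + 1873 / 2 * s ^+ 2).
Proof.
rewrite (eq_bigr (fun p => q p.1 * q p.2 * H p +
  1 / 2 * (q p.1 * q p.2 * H p ^+ 2) +
  78 * (q p.1 * q p.2 * pen p.1))); last by move=> p _; field.
rewrite !big_split /= -!mulr_sumr mH mHH (marg pen).
have -> : \sum_k q k * pen k =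
    lam ^+ 2 * (2 * (y ^+ 2 + S) * s + 10 * s ^+ 2).
  rewrite (eq_bigr (fun k => lam ^+ 2 * 2 * s * (q k * Y k ^+ 2) +
    lam ^+ 2 * 10 * s ^+ 2 * q k)); last by move=> k _; rewrite /pen; ring.
  by rewrite big_split /= -!mulr_sumr q1 qYY; ring.
have hs : 0 <= s := s0; have hS : 0 <= S := S0.
have Ss : S <= s := qs; have y20 := sqr_ge0 y.
have l0 := sqr_ge0 lam.
have h1 : (y ^+ 2 + S) ^+ 2 <= (y ^+ 2 + s) ^+ 2.
  by rewrite lerXn2r ?nnegrE ?addr_ge0// lerD2l.
have h2 : S * s <= s ^+ 2 by rewrite expr2 ler_wpM2r.
set L := (X in X <= _); set U := (X in _ <= X).
have -> : L = sg * lam * (y ^+ 2 - 1) + lam ^+ 2 *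
   (((y ^+ 2 + S) ^+ 2 - 2 * y ^+ 2 + 1) / 2 +
    78 * (2 * (y ^+ 2 + S) * s + 10 * s ^+ 2)) by rewrite /L; field.
have -> : U = sg * lam * (y ^+ 2 - 1) + lam ^+ 2 *
   (((y ^+ 2) ^+ 2 - 2 * y ^+ 2 + 1) / 2 +
    157 * (y ^+ 2 * s) + 1873 / 2 * s ^+ 2) by rewrite /U; field.
rewrite lerD2l; apply: ler_wpM2l => //.
move: h1 h2; rewrite !sqrrD; lra.
Qed.

End Decoupling.

(** * Numerical bounds on the entropy *)

Section Budget.
Context {R : realType}.

(** The tangent of ln at 80 is accurate enough because the argument in
    [entropy_budget] starts at 4 + 200 * 0.85 = 174. *)
Lemma ln_le_tangent (x : R) : 0 < x -> ln x <= 4 + x / 80.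
Proof.
move=> x0.
have e5 : 80 <= expR (5 : R).
  rewrite (_ : (5 : R) = 20%:R * (1 / 4)); last by field.
  rewrite expRM_natl; apply: (@le_trans _ _ ((5 / 4) ^+ 20)); first by lra.
  rewrite lerXn2r ?nnegrE ?expR_ge0//.
  by have := @expR_ge1Dx R (1 / 4); lra.
have : ln (x / 80) <= x / 80 - 1.
  have x80 : 0 < x / 80 by rewrite divr_gt0//; lra.
  have := @le_ln1Dx R (x / 80 - 1).
  by rewrite (_ : 1 + (x / 80 - 1) = x / 80); [apply; lra | lra].
rewrite ln_div ?posrE//.
have : ln (expR 5) >= ln (80 : R) by rewrite ler_ln ?posrE ?expR_gt0//; lra.
rewrite expRK; lra.
Qed.

(** Here x = z * Tm measures the signal-to-noise ratio of the rounding: 2 + 2 ln (...)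
    is the entropy per dimension of two roundings and 3.14 x + 0.19 the
    penalty for their variance.  The right-hand side is the budget
    6.81 * 2 x + 0.73 allowed by mu. *)
Lemma entropy_budget (x : R) : 17 / 20 <= x ->
  2 + 2 * ln (1 + 2 * Num.sqrt ((100 * x + 1) / 4)) + 314 / 100 * x + 19 / 100
  <= 1362 / 100 * x + 73 / 100.
Proof.
move=> hx; set r := Num.sqrt _.
have r0 : 0 <= r by exact: sqrtr_ge0.
have r2 : r ^+ 2 = (100 * x + 1) / 4 by rewrite sqr_sqrtr//; lra.
have -> : 2 * ln (1 + 2 * r) = ln ((1 + 2 * r) ^+ 2).
  by rewrite lnXn ?mulr_natl//; lra.
(* (1 + 2 r)^2 <= 2 + 8 r^2. *)
have : ln ((1 + 2 * r) ^+ 2) <= ln (4 + 200 * x).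
  rewrite ler_ln ?posrE ?exprn_gt0//; [|lra|lra].
  have := sqr_ge0 (1 - 2 * r); rewrite !sqrrD ?sqrrB; nra.
have := ln_le_tangent (4 + 200 * x); rewrite (_ : 0 < _); last lra.
by move=> /(_ isT); lra.
Qed.

Lemma add_entropy_budget (D lead zt x l e : R) : 0 < D -> zt <= x ->
  2 + 2 * l + 314 / 100 * x + 19 / 100 <= 1362 / 100 * x + 73 / 100 ->
  lead + D * (314 / 100 * zt + 1873 / 10000) - e +
    2 * (D * (1 / 2 + l) + D / 2) <=
  lead + D * (1362 / 100 * x + 73 / 100) - e.
Proof.
move=> D0 ztx h.
have hk : 314 / 100 * zt + 1873 / 10000 + 2 + 2 * l <=
    1362 / 100 * x + 73 / 100 by lra.
by have := ler_wpM2l (ltW D0) hk; rewrite !mulrDr; lra.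
Qed.

End Budget.

(** * Uniform deviations over all directions *)

Section CauchySchwarz.
Context {R : realType} {I : finType}.

Lemma cauchy_schwarz_sum (a x : I -> R) :
  (\sum_j a j * x j) ^+ 2 <= (\sum_j a j ^+ 2) * (\sum_j x j ^+ 2).
Proof.
have : 0 <= \sum_i \sum_j (a i * x j - a j * x i) ^+ 2.
  by apply: sumr_ge0 => i _; apply: sumr_ge0 => j _; exact: sqr_ge0.
rewrite (eq_bigr (fun i => \sum_j (a i ^+ 2 * x j ^+ 2 + a j ^+ 2 * x i ^+ 2) +
   - 2 * \sum_j (a i * x i) * (a j * x j))); last first.
  by move=> i _; rewrite mulr_sumr -big_split; apply: eq_bigr => j _ /=; ring.
rewrite big_split /= -mulr_sumr -big_distrlr /=.
rewrite (eq_bigr (fun i => a i ^+ 2 * (\sum_j x j ^+ 2) +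
   x i ^+ 2 * (\sum_j a j ^+ 2))); last first.
  by move=> i _; rewrite !mulr_sumr -big_split; apply: eq_bigr => j _ /=; ring.
rewrite big_split /= -!mulr_suml; nra.
Qed.

Lemma sqr_sum_le (a : I -> R) :
  (\sum_j a j) ^+ 2 <= #|I|%:R * (\sum_j a j ^+ 2).
Proof.
have := cauchy_schwarz_sum (fun=> 1) a.
rewrite sumr_const expr1n; under eq_bigr do rewrite mul1r.
by rewrite mulrC.
Qed.

End CauchySchwarz.

Section Deviation.
Context {disp disp' : measure_display} {T : measurableType disp}.
Context {T' : measurableType disp'} {R : realType} (P : probability T R).
Context (n : nat) (Xs : 'I_n -> {RV P >-> T'}) (X : {RV P >-> T'}).
Context {I : finType} (u : T' -> I -> R) (kp : R).
Hypothesis copies : independent_copies Xs X.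
Hypothesis measurable_u : forall j, measurable_fun setT (fun x => u x j).
Hypothesis u4 : forall j, integ P (fun w => u (X w) j ^+ 4).
Hypothesis Eu4 : forall j, Ex P (fun w => u (X w) j ^+ 4) <= kp.
Hypothesis I0 : (0 < #|I|)%N.

Let D : R := #|I|%:R.
Let D0 : 0 < D. Proof. by rewrite ltr0n. Qed.
Let U w j : R := u (X w) j.
Let W w : R := \sum_j U w j ^+ 2.
Let lin (v : I -> R) (x : I -> R) : R := \sum_j v j * x j.

Let W0 w : 0 <= W w. Proof. by apply: sumr_ge0 => j _; exact: sqr_ge0. Qed.

Let mlin v : measurable_fun setT (fun x => lin v (u x)).
Proof.
by apply: measurable_sum => j; apply: measurable_funM => //; exact: measurable_cst.
Qed.

Let mnorm : measurable_fun setT (fun x => \sum_j u x j ^+ 2).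
Proof. by apply: measurable_sum => j; exact: measurable_funX. Qed.

Let mX (f : T' -> R) : measurable_fun setT f -> measurable_fun setT (fun w => f (X w)).
Proof. by move=> mf; exact: (measurableT_comp mf). Qed.

Let integW2 : integ P (fun w => W w ^+ 2).
Proof.
apply: (integ_le P _ (fun w => D * \sum_j U w j ^+ 4)).
- by apply: measurable_funX; exact: mX mnorm.
- by apply: integZ; apply: integ_sum => j; exact: u4.
move=> w; rewrite ger0_norm ?sqr_ge0//.
apply: le_trans (sqr_sum_le _) _; rewrite ler_wpM2l ?ler0n//.
by apply: ler_sum => j _; rewrite -exprM.
Qed.

Let Ex_W2 : Ex P (fun w => W w ^+ 2) <= D ^+ 2 * kp.
Proof.
apply: (@le_trans _ _ (Ex P (fun w => D * \sum_j U w j ^+ 4))).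
  apply: le_Ex => //.
    by apply: integZ; apply: integ_sum => j; exact: u4.
  move=> w; apply: le_trans (sqr_sum_le _) _; rewrite ler_wpM2l ?ler0n//.
  by apply: ler_sum => j _; rewrite -exprM.
rewrite ExZ; last by apply: integ_sum => j; exact: u4.
rewrite Ex_sum; last by move=> j; exact: u4.
rewrite expr2 -mulrA ler_wpM2l ?ler0n//.
apply: (@le_trans _ _ (\sum_(j : I) kp)); first by apply: ler_sum => j _; exact: Eu4.
by rewrite sumr_const mulr_natl.
Qed.

Let lin_le v w : lin v (U w) ^+ 2 <= (\sum_j v j ^+ 2) * W w.
Proof. exact: cauchy_schwarz_sum. Qed.

(** All functions below are polynomials of degree at most 4 in the coordinates, hence
    dominated by a + b W^2. *)
Let integ_dom (f : T -> R) (a b : R) : measurable_fun setT f ->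
  (forall w, `|f w| <= a + b * W w ^+ 2) -> integ P f.
Proof.
move=> mf; apply: integ_le => //.
by apply: integD; [exact: integ_cst | exact: integZ].
Qed.

Let integ_lin4 v : integ P (fun w => lin v (U w) ^+ 4).
Proof.
apply: (integ_dom _ 0 ((\sum_j v j ^+ 2) ^+ 2)).
  by apply: measurable_funX; exact: mX (mlin v).
move=> w; rewrite add0r (_ : 4%N = (2 * 2)%N)// exprM ger0_norm ?sqr_ge0//.
rewrite -exprMn lerXn2r ?nnegrE ?sqr_ge0//.
by rewrite mulr_ge0// sumr_ge0// => j _; exact: sqr_ge0.
Qed.

Let integ_lin2 v : integ P (fun w => lin v (U w) ^+ 2).
Proof.
apply: (integ_le P _ (fun w => 1 + lin v (U w) ^+ 4)).
- by apply: measurable_funX; exact: mX (mlin v).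
- by apply: integD => //; exact: integ_cst.
move=> w; rewrite ger0_norm ?sqr_ge0//.
rewrite (_ : 4%N = (2 * 2)%N)// exprM.
by have := sqr_ge0 (lin v (U w) ^+ 2 - 1 / 2); nra.
Qed.

Section Scale.
Variables (lam sg sigma : R) (N : nat).
Hypothesis sg2 : sg ^+ 2 = 1.

Let glin (g : grid N) (x : I -> R) : R := \sum_j sigma * node g j * x j.
Let scale (x : I -> R) : R := sigma ^+ 2 / 4 * \sum_j x j ^+ 2.
Let H (p : @grid I N * @grid I N) x := sg * lam * (glin p.1 x * glin p.2 x - 1).
Let pen (g : @grid I N) x := lam ^+ 2 * (2 * glin g x ^+ 2 * scale x + 10 * scale x ^+ 2).
Let G p x := ln (trunc_quad (H p x)) + 3 * saturate (pen p.1 x).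
Let poly p x := H p x + H p x ^+ 2 / 2 + 78 * pen p.1 x.

Let scale0 x : 0 <= scale x.
Proof.
apply: mulr_ge0; first by rewrite divr_ge0 ?sqr_ge0.
by apply: sumr_ge0 => j _; exact: sqr_ge0.
Qed.

Let pen0 g x : 0 <= pen g x.
Proof.
apply: mulr_ge0; first exact: sqr_ge0.
apply: addr_ge0; last by rewrite mulr_ge0 ?sqr_ge0.
by apply: mulr_ge0 => //; rewrite mulr_ge0 ?sqr_ge0.
Qed.

Let mH p : measurable_fun setT (fun x => H p (u x)).
Proof.
apply: measurable_funM; first exact: measurable_cst.
apply: measurable_funB; last exact: measurable_cst.
by apply: measurable_funM; exact: mlin.
Qed.

Let mscale : measurable_fun setT (fun x => scale (u x)).
Proof. by apply: measurable_funM => //; exact: measurable_cst. Qed.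

Let mpen g : measurable_fun setT (fun x => pen g (u x)).
Proof.
apply: measurable_funM; first exact: measurable_cst.
apply: measurable_funD.
  apply: measurable_funM => //; apply: measurable_funM; first exact: measurable_cst.
  by apply: measurable_funX; exact: mlin.
apply: measurable_funM; first exact: measurable_cst.
exact: measurable_funX.
Qed.

Let mpoly p : measurable_fun setT (fun x => poly p (u x)).
Proof.
apply: measurable_funD; last first.
  by apply: measurable_funM; [exact: measurable_cst | exact: mpen].
apply: measurable_funD; first exact: mH.
by apply: measurable_funM; [apply: measurable_funX; exact: mH | exact: measurable_cst].
Qed.

Let mG p : measurable_fun setT (fun x => G p (u x)).
Proof.
apply: measurable_funD.
  apply: (measurableT_comp (@measurable_ln R)).
  apply: measurable_minr; last exact: measurable_cst.
  apply: measurable_funD.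
    by apply: measurable_funD; [exact: measurable_cst | exact: mH].
  by apply: measurable_funM; [apply: measurable_funX; exact: mH | exact: measurable_cst].
apply: measurable_funM; first exact: measurable_cst.
rewrite (_ : (fun x => saturate _) =
    fun x => pen p.1 (u x) * expR (- ln (1 + pen p.1 (u x)))).
  apply: measurable_funM; first exact: mpen.
  apply: (measurableT_comp (@measurable_expR R)); apply: measurable_funN.
  apply: (measurableT_comp (@measurable_ln R)).
  by apply: measurable_funD; [exact: measurable_cst | exact: mpen].
apply/funext => x; rewrite /saturate expRN lnK// posrE.
by have := pen0 p.1 (u x); lra.
Qed.

Let integ_poly p : integ P (fun w => poly p (U w)).
Proof.
pose c := \sum_j (sigma * node p.1 j) ^+ 2.
pose c' := \sum_j (sigma * node p.2 j) ^+ 2.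
pose k := sigma ^+ 2 / 4.
have c0 : 0 <= c by apply: sumr_ge0 => j _; exact: sqr_ge0.
have c0' : 0 <= c' by apply: sumr_ge0 => j _; exact: sqr_ge0.
have k0 : 0 <= k by rewrite divr_ge0 ?sqr_ge0.
apply: (integ_dom _ (1 + 2 * lam ^+ 2)
  (2 * lam ^+ 2 * (c * c') + 78 * (lam ^+ 2 * (2 * c * k + 10 * k ^+ 2)))).
  exact: mX (mpoly p).
move=> w.
have h1 : glin p.1 (U w) ^+ 2 <= c * W w by exact: cauchy_schwarz_sum.
have h2 : glin p.2 (U w) ^+ 2 <= c' * W w by exact: cauchy_schwarz_sum.
have l0 := sqr_ge0 lam; have w0 := W0 w.
have hh : (glin p.1 (U w) * glin p.2 (U w)) ^+ 2 <= c * c' * W w ^+ 2.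
  rewrite exprMn (_ : c * c' * W w ^+ 2 = (c * W w) * (c' * W w)); last by ring.
  by apply: ler_pM => //; exact: sqr_ge0.
have hH : H p (U w) ^+ 2 <= 2 * lam ^+ 2 * (c * c' * W w ^+ 2 + 1).
  rewrite (_ : H p (U w) ^+ 2 = sg ^+ 2 * lam ^+ 2 *
     (glin p.1 (U w) * glin p.2 (U w) - 1) ^+ 2); last by rewrite /H; ring.
  rewrite sg2 mul1r (_ : 2 * lam ^+ 2 * (c * c' * W w ^+ 2 + 1) =
     lam ^+ 2 * (2 * (c * c' * W w ^+ 2 + 1))); last by ring.
  apply: ler_wpM2l => //.
  move: hh; set h := glin _ _ * _ => hh.
  by have := sqr_ge0 (h + 1); nra.
have hpen : pen p.1 (U w) <= lam ^+ 2 * (2 * c * k + 10 * k ^+ 2) * W w ^+ 2.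
  rewrite /pen (_ : scale (U w) = k * W w)//.
  rewrite -[in X in _ <= X]mulrA; apply: ler_wpM2l => //.
  have : glin p.1 (U w) ^+ 2 * (k * W w) <= c * W w * (k * W w).
    by rewrite ler_wpM2r// mulr_ge0.
  nra.
have := pen0 p.1 (U w).
rewrite ler_norml /poly => hp; apply/andP; split.
  have := sqr_ge0 (H p (U w) + 1); have := sqr_ge0 (H p (U w)).
  have : 0 <= 2 * lam ^+ 2 * (c * c' * W w ^+ 2).
    have cc := mulr_ge0 (mulr_ge0 c0 c0') (sqr_ge0 (W w)).
    exact: mulr_ge0 (mulr_ge0 (ler0n R 2) l0) cc.
  have : 0 <= lam ^+ 2 * (2 * c * k + 10 * k ^+ 2) * W w ^+ 2 by lra.
  nra.
have := sqr_ge0 (H p (U w) - 1).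
nra.
Qed.

Let exp_moment p :
  (\int[P]_w (expR (G p (U w)))%:E <= (expR (Ex P (fun w => poly p (U w))))%:E)%E.
Proof.
apply: (@le_trans _ _ (\int[P]_w (1 + poly p (U w))%:E)%E).
  apply: ge0_le_integral => //.
  - apply/measurable_EFinP; apply: (measurableT_comp (@measurable_expR R)).
    exact: mX (mG p).
  - apply/measurable_EFinP; apply: measurable_funD; first exact: measurable_cst.
    exact: mX (mpoly p).
  - move=> w _; rewrite lee_fin.
    apply: le_trans (expR_summand_le _ _ (pen0 p.1 (U w))) _.
    by rewrite /poly -/(H p (U w)); lra.
have i1 : integ P (fun w => 1 + poly p (U w)).
  by apply: integD; [exact: integ_cst | exact: integ_poly].
rewrite -EFin_Ex// lee_fin ExD ?Ex_cst//; first exact: expR_ge1Dx.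
exact: integ_cst.
Qed.

(** The cross term y^2 s is split by weighted AM-GM into y^4 and s^2, each of
    which is controlled by the fourth-moment assumption; the weight del / t balances
    E y^4 <= kp t^2 against E s^2 <= kp del^2. *)
Let mean_poly_le (q : @grid I N -> R) (v : I -> R) (t del : R) :
  (forall g, 0 <= q g) -> \sum_g q g = 1 ->
  (forall x, \sum_g q g * glin g x = lin v x) ->
  (forall x, \sum_g q g * (glin g x - lin v x) ^+ 2 <= scale x) ->
  0 < t -> 0 < del -> sigma ^+ 2 / 4 = del / D ->
  Ex P (fun w => lin v (U w) ^+ 2) = t ->
  Ex P (fun w => lin v (U w) ^+ 4) <= kp * t ^+ 2 ->
  \sum_p q p.1 * q p.2 * Ex P (fun w => poly p (U w)) <=
  sg * lam * (t - 1) + lam ^+ 2 / 2 * (kp * t ^+ 2 - 2 * t + 1) +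
  lam ^+ 2 * kp * (157 * (t * del) + 1873 / 2 * del ^+ 2).
Proof.
move=> q0 q1 qv qs t0 d0 sd E2 E4.
have l0 := sqr_ge0 lam.
have -> : \sum_p q p.1 * q p.2 * Ex P (fun w => poly p (U w)) =
    Ex P (fun w => \sum_p q p.1 * q p.2 * poly p (U w)).
  rewrite Ex_sum; last by move=> p; apply: integZ; exact: integ_poly.
  by apply: eq_bigr => p _; rewrite ExZ//; exact: integ_poly.
pose c0 := - (sg * lam) + lam ^+ 2 / 2.
pose c1 := sg * lam - lam ^+ 2.
pose c2 := lam ^+ 2 / 2 + lam ^+ 2 * 157 * (del / t / 2).
pose c3 := lam ^+ 2 * (157 * (t / del / 2) + 1873 / 2) * (del / D) ^+ 2.
have dt : 0 <= del / t by rewrite divr_ge0// ltW.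
have td : 0 <= t / del by rewrite divr_ge0// ltW.
apply: (@le_trans _ _ (Ex P (fun w => c0 + (c1 * lin v (U w) ^+ 2 +
    (c2 * lin v (U w) ^+ 4 + c3 * W w ^+ 2))))).
  apply: le_Ex.
  - by apply: integ_sum => p; apply: integZ; exact: integ_poly.
  - apply: integD; first exact: integ_cst.
    by apply: integD; [exact: integZ | apply: integD; exact: integZ].
  move=> w.
  apply: le_trans (decoupled_poly_le q (fun g => glin g (U w)) (lin v (U w))
    (scale (U w)) lam sg q0 q1 (qv (U w)) (qs (U w)) sg2) _.
  set y := lin v (U w); set s := scale (U w).
  have sE : (del / D) ^+ 2 * W w ^+ 2 = s ^+ 2 by rewrite -exprMn /s /scale sd.
  have ys : y ^+ 2 * s <= del / t / 2 * y ^+ 4 + t / del / 2 * s ^+ 2.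
    rewrite -subr_ge0 (_ : _ - _ = del / t / 2 * (y ^+ 2 - t / del * s) ^+ 2).
      by rewrite mulr_ge0 ?sqr_ge0// divr_ge0.
    by field; rewrite !gt_eqF.
  have : lam ^+ 2 * 157 * (y ^+ 2 * s) <= lam ^+ 2 * 157 *
     (del / t / 2 * y ^+ 4 + t / del / 2 * s ^+ 2) by rewrite ler_wpM2l// mulr_ge0.
  rewrite /c0 /c1 /c2 /c3 -[_ * _ * W w ^+ 2]mulrA sE.
  lra.
rewrite ExD; last 2 first.
- exact: integ_cst.
- by apply: integD; [exact: integZ | apply: integD; exact: integZ].
rewrite Ex_cst ExD; last 2 first.
- exact: integZ.
- by apply: integD; exact: integZ.
rewrite ExD; last 2 first.
- exact: integZ.
- exact: integZ.
rewrite !ExZ// E2.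
have k1 : 0 <= 157 * (t / del / 2) + 1873 / 2 by lra.
have k2 : 0 <= 1 / 2 + 157 * (del / t / 2) by lra.
have c20 : 0 <= c2.
  rewrite (_ : c2 = lam ^+ 2 * (1 / 2 + 157 * (del / t / 2))).
    exact: mulr_ge0 l0 k2.
  by rewrite /c2; field; rewrite gt_eqF.
have c30 : 0 <= c3 := mulr_ge0 (mulr_ge0 l0 k1) (sqr_ge0 _).
have := ler_wpM2l c20 E4; have := ler_wpM2l c30 Ex_W2.
have -> : c2 * (kp * t ^+ 2) = lam ^+ 2 / 2 * kp * t ^+ 2 +
   lam ^+ 2 * kp * (157 / 2 * (t * del)) by rewrite /c2; field; rewrite gt_eqF.
have -> : c3 * (D ^+ 2 * kp) =
   lam ^+ 2 * kp * (157 / 2 * (t * del) + 1873 / 2 * del ^+ 2).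
  by rewrite /c3; field; rewrite !gt_eqF.
rewrite /c0 /c1; lra.
Qed.

(** The PAC-Bayes bound: the event depends on the grid only, and any posterior q
    with the right mean and variance may be chosen afterwards. *)
Let psi_sum_le (eta eps : R) : 0 < eta -> 0 < eps ->
  exists A : set T, [/\ measurable A, ((1 - eps)%:E <= P A)%E &
    forall w, A w -> forall (q : @grid I N -> R) (v : I -> R),
    (forall g, 0 <= q g) -> \sum_g q g = 1 ->
    (forall x, \sum_g q g * glin g x = lin v x) ->
    (forall x, \sum_g q g * (glin g x - lin v x) ^+ 2 <= scale x) ->
    \sum_i psi (sg * lam * (lin v (u (Xs i w)) ^+ 2 - 1)) <=
    n%:R * (\sum_p q p.1 * q p.2 * Ex P (fun w => poly p (U w))) - ln eps +
    2 * (D * (1 / 2 + ln (1 + 2 / eta)) +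
         eta ^+ 2 / 2 * \sum_g q g * \sum_j node g j ^+ 2)].
Proof.
move=> eta0 eps0.
have [pi [pi0 pi1 lnpi]] := @grid_prior R I N eta eta0.
have ps (a b : @grid I N -> R) :
    \sum_p a p.1 * b p.2 = (\sum_k a k) * (\sum_k b k).
  by rewrite big_distrlr /= pair_bigA /=; apply: eq_bigr => -[].
have [//|||||A [mA PA hA]] := @weighted_union_bound _ _ _ _ R P n Xs X
  (@grid I N * @grid I N)%type (fun p => pi p.1 * pi p.2)
  (fun p x => G p (u x)) (fun p => Ex P (fun w => poly p (U w))) eps copies.
- by move=> p; rewrite mulr_gt0.
- rewrite (ps pi pi) -[leRHS]mulr1 ler_pM//.
    by apply: sumr_ge0 => g _; exact: ltW.
  by apply: sumr_ge0 => g _; exact: ltW.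
- exact: eps0.
- by move=> p; exact: mG.
- by move=> p; exact: exp_moment.
exists A; split => // w Aw q v q0 q1 qv qs.
apply: (@le_trans _ _ (\sum_i \sum_p q p.1 * q p.2 * G p (u (Xs i w)))).
  apply: ler_sum => i _.
  exact: (psi_le_decoupled q (fun g => glin g (u (Xs i w))) (lin v (u (Xs i w)))
    (scale (u (Xs i w))) lam sg q0 q1 (qv _) (qs _) sg2).
rewrite exchange_big /=.
apply: (@le_trans _ _ (\sum_p q p.1 * q p.2 *
   (n%:R * Ex P (fun w => poly p (U w)) - ln eps - ln (pi p.1) - ln (pi p.2)))).
  apply: ler_sum => p _; rewrite -mulr_sumr; apply: ler_wpM2l; first exact: mulr_ge0.
  have := hA w Aw p; rewrite lnM ?posrE//; lra.
rewrite (eq_bigr (fun p => n%:R * (q p.1 * q p.2 * Ex P (fun w => poly p (U w))) +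
   (- ln eps) * (q p.1 * q p.2) + (q p.1 * - ln (pi p.1)) * q p.2 +
   q p.1 * (q p.2 * - ln (pi p.2)))); last by move=> p _; ring.
rewrite !big_split /= -!mulr_sumr (ps (fun g => q g * - ln (pi g)) q).
rewrite (ps q (fun g => q g * - ln (pi g))) (ps q q) q1 !mulr1 mul1r.
have : \sum_g q g * - ln (pi g) <= D * (1 / 2 + ln (1 + 2 / eta)) +
         eta ^+ 2 / 2 * \sum_g q g * \sum_j node g j ^+ 2.
  apply: le_trans (_ : _ <= \sum_g q g * (D * (1 / 2 + ln (1 + 2 / eta)) +
     eta ^+ 2 / 2 * \sum_j node g j ^+ 2)) _.
    by apply: ler_sum => g _; apply: ler_wpM2l => //; exact: lnpi.
  rewrite (eq_bigr (fun g => (D * (1 / 2 + ln (1 + 2 / eta))) * q g +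
    eta ^+ 2 / 2 * (q g * \sum_j node g j ^+ 2))); last by move=> g _; ring.
  by rewrite big_split /= -!mulr_sumr q1 mulr1.
lra.
Qed.

(** The posterior is the random rounding of v; its second moment on the lattice
    enters through the quadratic cost of [grid_prior]. *)
Lemma psi_sum_le_rounded (Tm eta del eps : R) :
  0 < sigma -> 0 < eta -> 0 < eps -> 0 < del -> sigma ^+ 2 = 4 * del / D ->
  Num.sqrt Tm / sigma + 2 <= N%:R -> 0 <= Tm ->
  exists A : set T, [/\ measurable A, ((1 - eps)%:E <= P A)%E &
    forall w, A w -> forall (v : I -> R) (t : R),
    \sum_j v j ^+ 2 <= Tm -> 0 < t ->
    Ex P (fun w => (\sum_j v j * u (X w) j) ^+ 2) = t ->
    Ex P (fun w => (\sum_j v j * u (X w) j) ^+ 4) <= kp * t ^+ 2 ->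
    \sum_i psi (sg * lam * ((\sum_j v j * u (Xs i w) j) ^+ 2 - 1)) <=
    n%:R * (sg * lam * (t - 1) + lam ^+ 2 / 2 * (kp * t ^+ 2 - 2 * t + 1) +
     lam ^+ 2 * kp * (157 * (t * del) + 1873 / 2 * del ^+ 2)) - ln eps +
    2 * (D * (1 / 2 + ln (1 + 2 / eta)) +
         eta ^+ 2 / 2 * (D * (Tm / del + 1) / 4))].
Proof.
move=> s0 eta0 eps0 d0 sd hN Tm0.
have [A [mA PA hA]] := psi_sum_le eta eps eta0 eps0.
exists A; split => // w Aw v t vT t0 E2 E4.
have hv j : `|v j| / sigma + 2 <= N%:R.
  apply: le_trans hN; rewrite lerD2r ler_pM2r ?invr_gt0//.
  rewrite -sqrtr_sqr ler_sqrt//; apply: le_trans vT.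
  by rewrite (bigD1 j)//= lerDl; apply: sumr_ge0 => i _; exact: sqr_ge0.
have [q [q0 q1 qv qs qn]] := rounding sigma N v s0 hv.
apply: le_trans (hA w Aw q v q0 q1 qv qs) _.
have sd' : sigma ^+ 2 / 4 = del / D by rewrite sd; field; rewrite gt_eqF.
have h1 := mean_poly_le q v t del q0 q1 qv qs t0 d0 sd' E2 E4.
have h2 : \sum_g q g * \sum_j node g j ^+ 2 <= D * (Tm / del + 1) / 4.
  apply: le_trans qn _.
  have : (\sum_j v j ^+ 2) / sigma ^+ 2 <= Tm / sigma ^+ 2.
    by rewrite ler_pM2r ?invr_gt0 ?exprn_gt0.
  rewrite [in X in _ <= X -> _]sd -/D.
  rewrite (_ : D * (Tm / del + 1) / 4 = Tm / (4 * del / D) + D / 4); first by lra.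
  by field; rewrite !gt_eqF.
have e2 : 0 <= eta ^+ 2 / 2 by rewrite divr_ge0 ?sqr_ge0.
have := ler_wpM2l e2 h2.
have := ler_wpM2l (ler0n R n) h1.
lra.
Qed.

End Scale.

(** The rounding variance is 1 / (100 z), where z compares the exponent
    lam with sqrt (D / (n kp)); then n lam^2 kp = 2 D z^2 turns both penalties of
    [mean_poly_le] into multiples of D.  The prior parameter 1 / r equalises the two
    parts of its cost. *)
Lemma uniform_deviation (lam sg Tm eps : R) :
  sg ^+ 2 = 1 -> 0 < eps -> 1 <= Tm -> 0 < lam -> 0 < kp -> (0 < n)%N ->
  let z := lam * Num.sqrt (n%:R * kp / (2 * D)) in 17 / 20 <= z ->
  exists A : set T, [/\ measurable A, ((1 - eps)%:E <= P A)%E &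
    forall w, A w -> forall (v : I -> R) (t : R),
    \sum_j v j ^+ 2 <= Tm -> 0 < t <= Tm ->
    Ex P (fun w => (\sum_j v j * u (X w) j) ^+ 2) = t ->
    Ex P (fun w => (\sum_j v j * u (X w) j) ^+ 4) <= kp * t ^+ 2 ->
    \sum_i psi (sg * lam * ((\sum_j v j * u (Xs i w) j) ^+ 2 - 1)) <=
    n%:R * (sg * lam * (t - 1) + lam ^+ 2 / 2 * (kp * t ^+ 2 - 2 * t + 1)) +
    D * (1362 / 100 * (z * Tm) + 73 / 100) - ln eps].
Proof.
move=> sg2 eps0 Tm1 lam0 kp0 n0 z hz.
have z0 : 0 < z by lra.
have D0' : 0 < D := D0.
pose del := (100 * z)^-1.
have d0 : 0 < del by rewrite invr_gt0; lra.
pose sigma := Num.sqrt (4 * del / D).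
have sd0 : 0 < 4 * del / D by rewrite divr_gt0//; lra.
have s0 : 0 < sigma by rewrite sqrtr_gt0.
have sd : sigma ^+ 2 = 4 * del / D by rewrite sqr_sqrtr// ltW.
pose x := z * Tm.
have hx : 17 / 20 <= x by rewrite /x; nra.
pose r := Num.sqrt ((100 * x + 1) / 4).
have r0 : 0 < r by rewrite sqrtr_gt0; lra.
have r2 : r ^+ 2 = (100 * x + 1) / 4 by rewrite sqr_sqrtr//; lra.
have eta0 : 0 < r^-1 by rewrite invr_gt0.
pose N := (Num.truncn (Num.sqrt Tm / sigma + 2)).+1.
have hN : Num.sqrt Tm / sigma + 2 <= N%:R by apply/ltW; exact: truncnS_gt.
have Tm0 : 0 <= Tm by lra.
have [A [mA PA hA]] := psi_sum_le_rounded lam sg sigma N sg2 Tm r^-1 del eps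
  s0 eta0 eps0 d0 sd hN Tm0.
exists A; split => // w Aw v t vT /andP[t0 tT] E2 E4.
apply: le_trans (hA w Aw v t vT t0 E2 E4) _.
have Td : Tm / del = 100 * x by rewrite /del /x invrK; ring.
have z2 : n%:R * (lam ^+ 2 * kp) = 2 * D * z ^+ 2.
  rewrite /z exprMn sqr_sqrtr; first by field; rewrite gt_eqF.
  by apply: divr_ge0; apply: mulr_ge0; rewrite ?ler0n// ltW.
have e1 : r^-1 ^+ 2 / 2 * (D * (Tm / del + 1) / 4) = D / 2.
  rewrite Td (_ : D * (100 * x + 1) / 4 = D * r ^+ 2); last by rewrite r2; field.
  by field; rewrite gt_eqF.
have e2 : n%:R * (lam ^+ 2 * kp * (157 * (t * del) + 1873 / 2 * del ^+ 2)) =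
    D * (314 / 100 * (z * t) + 1873 / 10000).
  by rewrite mulrA z2 /del; field; rewrite gt_eqF.
have := entropy_budget x hx; rewrite -/r => hb.
have zt : z * t <= x by rewrite /x ler_wpM2l// ltW.
rewrite e1 invrK mulrDr e2.
exact: add_entropy_budget D0' zt hb.
Qed.

End Deviation.

(** * Whitening *)

Section GramSchmidt.
Context {R : realType} {V : lmodType R} (B : V -> V -> R).
Hypothesis Bsym : forall x y, B x y = B y x.
Hypothesis Blin : forall a x y z, B (a *: x + y) z = a * B x z + B y z.
Hypothesis Bpos : forall x, 0 <= B x x.

Lemma form0 z : B 0 z = 0.
Proof. by have := Blin 1 0 0 z; rewrite scaler0 addr0 mul1r; lra. Qed.

Lemma formD x y z : B (x + y) z = B x z + B y z.
Proof. by have := Blin 1 x y z; rewrite scale1r mul1r. Qed.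

Lemma formZ a x z : B (a *: x) z = a * B x z.
Proof. by have := Blin a x 0 z; rewrite addr0 form0 addr0. Qed.

Lemma form_sum (I : Type) (r : seq I) (Q : pred I) (a : I -> R) (x : I -> V) z :
  B (\sum_(i <- r | Q i) a i *: x i) z = \sum_(i <- r | Q i) a i * B (x i) z.
Proof.
elim/big_ind2 : _ => [|x1 x2 y1 y2 h1 h2|i _]; first exact: form0.
  by rewrite formD h1 h2.
exact: formZ.
Qed.

(** Null vectors of a semi-definite form are orthogonal to everything: otherwise the
    form would become negative on a line. *)
Lemma form_null x y : B x x = 0 -> B x y = 0.
Proof.
move=> x0; have h a : 0 <= 2 * a * B x y + B y y.
  have := Bpos (a *: x + y).
  by rewrite Blin Bsym Blin x0 (Bsym y (_ + _)) Blin (Bsym y x); lra.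
apply/eqP; rewrite eq_le; apply/andP; split; rewrite leNgt; apply/negP => hlt.
  have := h (- (B y y + 1) / (2 * B x y)).
  rewrite (_ : 2 * (- (B y y + 1) / (2 * B x y)) * B x y = - (B y y + 1)); first by lra.
  by field; rewrite gt_eqF.
have := h (- (B y y + 1) / (2 * B x y)).
rewrite (_ : 2 * (- (B y y + 1) / (2 * B x y)) * B x y = - (B y y + 1)); first by lra.
by field; rewrite lt_eqF.
Qed.

(** Gram-Schmidt for a form that may be degenerate: a null residual is replaced by 0
    rather than normalised, so the family keeps the length of the input. *)
Lemma gram_schmidt (m : nat) (e : nat -> V) :
  exists f : nat -> V,
    [/\ forall i, (i < m)%N -> f i = 0 \/ B (f i) (f i) = 1,
        forall i j, (i < m)%N -> (j < m)%N -> i != j -> B (f i) (f j) = 0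
      & forall i, (i < m)%N ->
          let r := e i - \sum_(k < m) B (e i) (f k) *: f k in B r r = 0].
Proof.
elim: m => [|m [f [fn fo fr]]]; first by exists (fun=> 0); split.
pose p i := \sum_(k < m) B (e i) (f k) *: f k.
pose e' := e m - p m.
have pf i j : (j < m)%N -> B (p i) (f j) = B (e i) (f j).
  move=> jm; rewrite form_sum (bigD1 (Ordinal jm))//= big1 ?addr0.
    by case: (fn j jm) => [->|->]; rewrite ?mulr1// (Bsym (e i)) !form0 mulr0.
  by move=> k kj; rewrite fo ?mulr0.
have e'f j : (j < m)%N -> B e' (f j) = 0.
  move=> jm; rewrite /e' formD -scaleN1r formZ pf//; lra.
pose g := if B e' e' == 0 then 0 else (Num.sqrt (B e' e'))^-1 *: e'.
pose f' i := if i == m then g else f i.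
have f'm : f' m = g by rewrite /f' eqxx.
have f'lt i : (i < m)%N -> f' i = f i by move=> im; rewrite /f' ltn_eqF.
have gf j : (j < m)%N -> B g (f j) = 0.
  move=> jm; rewrite /g; case: ifP => _; first exact: form0.
  by rewrite formZ e'f// mulr0.
have sumE i : \sum_(k < m.+1) B (e i) (f' k) *: f' k = p i + B (e i) g *: g.
  rewrite big_ord_recr /= f'm; congr (_ + _).
  by apply: eq_bigr => k _; rewrite f'lt.
exists f'; split.
- move=> i; rewrite ltnS leq_eqVlt => /predU1P[->|im]; last by rewrite f'lt//; exact: fn.
  rewrite f'm /g; case: eqP => [_|/eqP h]; [by left | right].
  have h0 : 0 < B e' e' by rewrite lt_neqAle eq_sym h Bpos.
  rewrite formZ Bsym formZ mulrA -invfM -expr2 sqr_sqrtr ?ltW// mulVf//.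
- move=> i j; rewrite !ltnS leq_eqVlt => /predU1P[->|im].
    rewrite leq_eqVlt => /predU1P[->|jm]; first by rewrite eqxx.
    by move=> _; rewrite f'm f'lt// gf.
  rewrite leq_eqVlt => /predU1P[->|jm].
    by move=> _; rewrite f'm f'lt// Bsym gf.
  by move=> ij; rewrite !f'lt//; exact: fo.
- move=> i; rewrite ltnS leq_eqVlt => /predU1P[->|im] /=; rewrite sumE.
    have pg : B (p m) g = 0.
      rewrite form_sum big1// => k _; by rewrite (Bsym (f k)) gf// mulr0.
    have -> : B (e m) g = B e' g by rewrite /e' formD -scaleN1r formZ pg mulr0 addr0.
    rewrite opprD addrA -/e' /g; case: eqP => [h|/eqP h].
      by rewrite scaler0 subr0.
    have h0 : 0 < B e' e' by rewrite lt_neqAle eq_sym h Bpos.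
    rewrite Bsym formZ scalerA mulrAC -invfM -expr2 sqr_sqrtr ?ltW// mulVf//.
    by rewrite scale1r subrr form0.
  have h := fr i im; rewrite /= -/(p i) in h.
  have : B (e i) g = 0.
    have -> : e i = (e i - p i) + p i by rewrite subrK.
    rewrite formD (form_null _ g h) add0r form_sum big1// => k _.
    by rewrite (Bsym (f k)) gf// mulr0.
  by move=> ->; rewrite scale0r addr0.
Qed.

End GramSchmidt.

Section Dot.
Context {R : realType} {d : nat}.
Implicit Types (u v w : 'rV[R]_d).

Lemma dotDl u v w : dot (u + v) w = dot u w + dot v w.
Proof. by rewrite /dot -big_split; apply: eq_bigr => j _; rewrite !mxE mulrDl. Qed.

Lemma dotZl a u w : dot (a *: u) w = a * dot u w.
Proof. by rewrite /dot mulr_sumr; apply: eq_bigr => j _; rewrite !mxE mulrA. Qed.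

Lemma dot0l w : dot 0 w = 0.
Proof. by rewrite /dot big1// => j _; rewrite mxE mul0r. Qed.

Lemma dotBr u v w : dot u (v - w) = dot u v - dot u w.
Proof. by rewrite /dot -sumrB; apply: eq_bigr => j _; rewrite !mxE mulrBr. Qed.

Lemma dot_suml (I : Type) (r : seq I) (Q : pred I) (f : I -> 'rV[R]_d) w :
  dot (\sum_(i <- r | Q i) f i) w = \sum_(i <- r | Q i) dot (f i) w.
Proof.
elim/big_ind2 : _ => // [|x1 x2 y1 y2 h1 h2]; first exact: dot0l.
by rewrite dotDl h1 h2.
Qed.

End Dot.

Section BorelVector.
Context {R : realType} {d : nat}.

Lemma measurable_coord (j : 'I_d) :
  measurable_fun setT (fun x : borelRV R d => (x : 'rV[R]_d) ord0 j).
Proof.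
apply: (measurability _ (RGenOInfty.measurableE R)) => _ [_ [a ->] <-].
rewrite setTI; apply: sub_sigma_algebra.
have := @coord_continuous R 1 d ord0 j => /continuousP; apply.
by apply: interval_open.
Qed.

Lemma measurable_dot_sub (theta m : 'rV[R]_d) :
  measurable_fun setT (fun x : borelRV R d => dot theta ((x : 'rV[R]_d) - m)).
Proof.
rewrite /dot; apply: measurable_sum => j; apply: measurable_funM.
  exact: measurable_cst.
rewrite (_ : (fun x : borelRV R d => _) = (fun x : borelRV R d => (x : 'rV[R]_d) ord0 j - m ord0 j)).
  by apply: measurable_funB; [exact: measurable_coord | exact: measurable_cst].
by apply/funext => x; rewrite !mxE.
Qed.

End BorelVector.

(** * Moments of the centred and augmented vector *)

Section AlmostSure.
Context {R : realType} {disp : measure_display} {T : measurableType disp}.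
Variable P : probability T R.

Lemma probability_setI_ge (A B : set T) (a b : R) :
  measurable A -> measurable B ->
  ((1 - a)%:E <= P A)%E -> ((1 - b)%:E <= P B)%E ->
  ((1 - (a + b))%:E <= P (A `&` B))%E.
Proof.
move=> mA mB.
have compl C : measurable C -> P C = (1 - fine (P (~` C)))%:E.
  move=> mC; rewrite EFinB fineK ?fin_num_measure//; last exact: measurableC.
  by rewrite -probability_setC ?setCK//; exact: measurableC.
have mAB := measurableI _ _ mA mB.
rewrite (compl A)// (compl B)// (compl _ mAB) !lee_fin => ha hb.
have : (P (~` (A `&` B)) <= P (~` A) + P (~` B))%E.
  by rewrite setCI; apply: measureU2; exact: measurableC.
rewrite -[P (~` A)]fineK ?fin_num_measure//; last exact: measurableC.
rewrite -[P (~` B)]fineK ?fin_num_measure//; last exact: measurableC.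
rewrite -[P (~` (A `&` B))]fineK ?fin_num_measure//; last exact: measurableC.
by rewrite -EFinD lee_fin; lra.
Qed.

Lemma finite_almost_sure (K : finType) (Q : K -> T -> Prop) :
  (forall k, exists A, [/\ measurable A, P A = 1%E & forall w, A w -> Q k w]) ->
  exists A, [/\ measurable A, P A = 1%E & forall w, A w -> forall k, Q k w].
Proof.
move=> /choice[f hf].
suff h (s : seq K) : exists A, [/\ measurable A, P A = 1%E &
    forall w, A w -> forall k, k \in s -> Q k w].
  have [A [mA PA hA]] := h (enum K).
  by exists A; split => // w Aw k; apply: hA => //; rewrite mem_enum.
elim: s => [|k s [A [mA PA hA]]].
  by exists setT; split => //; exact: probability_setT.
have [mf Pf Qf] := hf k.
exists (f k `&` A); split; first exact: measurableI.
  have mfA := measurableI _ _ mf mA.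
  apply/eqP; rewrite eq_le probability_le1//=.
  have := @probability_setI_ge (f k) A 0 0 mf mA.
  by rewrite addr0 subr0 Pf PA; apply.
by move=> w [fw Aw] i; rewrite inE => /predU1P[->|]; [exact: Qf | exact: hA].
Qed.

End AlmostSure.

Section Moments.
Context {R : realType} {disp : measure_display} {T : measurableType disp}.
Context (P : probability T R) (d : nat) (X : {RV P >-> borelRV R d}) (kappa : R).
Hypothesis X2 : ('E_P[fun w => (enorm (X w : 'rV[R]_d) ^+ 2)%R] < +oo)%E.
Hypothesis kappa0 : 0 < kappa.
Hypothesis kurtosis : forall theta : 'rV[R]_d,
  (central_moment P 4 X theta <= kappa%:E * central_moment P 2 X theta ^+ 2)%E.

Definition mean : 'rV[R]_d := mean_vector P X.
Definition centred (theta : 'rV[R]_d) (w : T) : R :=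
  dot theta ((X w : 'rV[R]_d) - mean).

Let mcoord j : measurable_fun setT (fun w => (X w : 'rV[R]_d) ord0 j).
Proof. exact: (measurableT_comp (measurable_coord j)). Qed.

Lemma measurable_centred theta : measurable_fun setT (centred theta).
Proof. exact: (measurableT_comp (measurable_dot_sub theta mean)). Qed.

Let enormE w : enorm (X w : 'rV[R]_d) ^+ 2 = \sum_j (X w : 'rV[R]_d) ord0 j ^+ 2.
Proof.
by rewrite /enorm sqr_sqrtr// /dot; apply: sumr_ge0 => j _; rewrite -expr2 sqr_ge0.
Qed.

Let integ_norm2 : integ P (fun w => \sum_j (X w : 'rV[R]_d) ord0 j ^+ 2).
Proof.
have m2 : measurable_fun setT (fun w => \sum_j (X w : 'rV[R]_d) ord0 j ^+ 2).
  by apply: measurable_sum => j; exact: measurable_funX.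
apply/integrableP; split; first exact/measurable_EFinP.
move: X2; rewrite unlock; apply: le_lt_trans.
rewrite le_eqVlt; apply/orP; left; apply/eqP; apply: eq_integral => w _ /=.
by rewrite enormE ger0_norm//; apply: sumr_ge0 => j _; exact: sqr_ge0.
Qed.

Let integ_coord j : integ P (fun w => (X w : 'rV[R]_d) ord0 j).
Proof.
apply: (integ_le P _ (fun w => 1 + \sum_j (X w : 'rV[R]_d) ord0 j ^+ 2)) => //.
  by apply: integD => //; exact: integ_cst.
move=> w; rewrite (bigD1 j)//=.
have : 0 <= \sum_(i | i != j) (X w : 'rV[R]_d) ord0 i ^+ 2.
  by apply: sumr_ge0 => i _; exact: sqr_ge0.
set x := (X w : 'rV[R]_d) ord0 j; rewrite ler_norml.
have := sqr_ge0 (x - 1); have := sqr_ge0 (x + 1); nra.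
Qed.

Let Ex_coord j : Ex P (fun w => (X w : 'rV[R]_d) ord0 j) = mean ord0 j.
Proof. by rewrite mxE unlock. Qed.

Lemma centredE theta w :
  centred theta w = \sum_j theta ord0 j * ((X w : 'rV[R]_d) ord0 j - mean ord0 j).
Proof. by rewrite /centred /dot; apply: eq_bigr => j _; rewrite !mxE. Qed.

Let integ_coord_centred j : integ P (fun w => (X w : 'rV[R]_d) ord0 j - mean ord0 j).
Proof. by apply: integD => //; exact: integ_cst. Qed.

Lemma integ_centred theta : integ P (centred theta).
Proof.
rewrite (_ : centred theta = fun w =>
  \sum_j theta ord0 j * ((X w : 'rV[R]_d) ord0 j - mean ord0 j)).
  by apply: integ_sum => j; exact: integZ.
by apply/funext => w; rewrite centredE.
Qed.

Lemma Ex_centred theta : Ex P (centred theta) = 0.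
Proof.
rewrite (_ : centred theta = fun w =>
  \sum_j theta ord0 j * ((X w : 'rV[R]_d) ord0 j - mean ord0 j)); last first.
  by apply/funext => w; rewrite centredE.
rewrite Ex_sum => [|j]; last exact: integZ.
apply: big1 => j _; rewrite ExZ// ExD//; last exact: integ_cst.
by rewrite Ex_coord Ex_cst subrr mulr0.
Qed.

Lemma integ_centred2 theta : integ P (fun w => centred theta w ^+ 2).
Proof.
pose c := \sum_j theta ord0 j ^+ 2.
have c0 : 0 <= c by apply: sumr_ge0 => j _; exact: sqr_ge0.
pose a := \sum_j mean ord0 j ^+ 2.
apply: (integ_le P _ (fun w => c * (2 * a) + c * 2 * \sum_j (X w : 'rV[R]_d) ord0 j ^+ 2)).
- by apply: measurable_funX; exact: measurable_centred.
- by apply: integD; [exact: integ_cst | exact: integZ].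
move=> w; rewrite ger0_norm ?sqr_ge0// centredE.
apply: le_trans (cauchy_schwarz_sum _ _) _; rewrite -/c.
rewrite -mulrA -mulrDr ler_wpM2l// /a !mulr_sumr -big_split /=.
apply: ler_sum => j _; set x := (X w : 'rV[R]_d) ord0 j.
by have := sqr_ge0 (x + mean ord0 j); nra.
Qed.

Definition covar (theta eta : 'rV[R]_d) : R :=
  Ex P (fun w => centred theta w * centred eta w).

Lemma integ_centredM theta eta : integ P (fun w => centred theta w * centred eta w).
Proof.
apply: (integ_le P _ (fun w => centred theta w ^+ 2 + centred eta w ^+ 2)).
- by apply: measurable_funM; exact: measurable_centred.
- by apply: integD; exact: integ_centred2.
move=> w; rewrite ler_norml.
set x := centred theta w; set y := centred eta w.
by have := sqr_ge0 (x - y); have := sqr_ge0 (x + y);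
  have := sqr_ge0 x; have := sqr_ge0 y; nra.
Qed.

Lemma covar_sym theta eta : covar theta eta = covar eta theta.
Proof. by congr (Ex P _); apply/funext => w; rewrite mulrC. Qed.

Lemma centred_lin a theta theta' w :
  centred (a *: theta + theta') w = a * centred theta w + centred theta' w.
Proof. by rewrite /centred dotDl dotZl. Qed.

Lemma covar_lin a theta theta' eta :
  covar (a *: theta + theta') eta = a * covar theta eta + covar theta' eta.
Proof.
rewrite /covar -ExZ -?ExD; first last.
- exact: integ_centredM.
- exact: integ_centredM.
- by apply: integZ; exact: integ_centredM.
by congr (Ex P _); apply/funext => w; rewrite centred_lin; ring.
Qed.

Lemma covar_ge0 theta : 0 <= covar theta theta.
Proof. by apply: Ex_ge0 => w; rewrite -expr2 sqr_ge0. Qed.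

Lemma covar_diag theta : covar theta theta = Ex P (fun w => centred theta w ^+ 2).
Proof. by congr (Ex P _); apply/funext => w; rewrite expr2. Qed.

Lemma central_moment2E theta :
  central_moment P 2 X theta = (covar theta theta)%:E.
Proof.
rewrite covar_diag EFin_Ex; last exact: integ_centred2.
by rewrite /central_moment unlock.
Qed.

Lemma integ_centred4 theta : integ P (fun w => centred theta w ^+ 4).
Proof.
apply/integrableP; split.
  by apply/measurable_EFinP; apply: measurable_funX; exact: measurable_centred.
have := kurtosis theta; rewrite central_moment2E /central_moment unlock => h.
apply: le_lt_trans (_ : _ <= \int[P]_w (centred theta w ^+ 4)%:E)%E _; last first.
  by apply: (le_lt_trans h); rewrite -EFin_expe -EFinM ltry.
rewrite le_eqVlt; apply/orP; left; apply/eqP; apply: eq_integral => w _ /=.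
by rewrite ger0_norm// exprn_even_ge0.
Qed.

Lemma Ex_centred4_le theta :
  Ex P (fun w => centred theta w ^+ 4) <= kappa * covar theta theta ^+ 2.
Proof.
rewrite -lee_fin EFin_Ex; last exact: integ_centred4.
have := kurtosis theta; rewrite central_moment2E /central_moment unlock.
by rewrite -EFin_expe -EFinM.
Qed.

(** Jensen's inequality (E Z^2)^2 <= E Z^4 against the kurtosis bound. *)
Lemma covar_sqr_le_kurtosis theta : covar theta theta ^+ 2 <= kappa * covar theta theta ^+ 2.
Proof.
apply: le_trans (Ex_centred4_le theta).
set s := covar theta theta.
have : Ex P (fun w => (- s ^+ 2) + (2 * s) * centred theta w ^+ 2) <=
       Ex P (fun w => centred theta w ^+ 4).
  apply: le_Ex => [||w].
  - by apply: integD; [exact: integ_cst | apply: integZ; exact: integ_centred2].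
  - exact: integ_centred4.
  have := sqr_ge0 (centred theta w ^+ 2 - s).
  rewrite (_ : 4%N = (2 * 2)%N)// exprM; nra.
rewrite ExD; first last.
- by apply: integZ; exact: integ_centred2.
- exact: integ_cst.
rewrite Ex_cst ExZ; last exact: integ_centred2.
by rewrite -covar_diag -/s; lra.
Qed.

Lemma covar_eq0 : kappa < 1 -> forall theta, covar theta theta = 0.
Proof.
move=> k1 theta; have := covar_sqr_le_kurtosis theta; set s := covar _ _ => h.
by apply/eqP; rewrite -sqrf_eq0 eq_le sqr_ge0 andbT; have := sqr_ge0 s; nra.
Qed.

Lemma Ex_shift2 (a : R) theta :
  Ex P (fun w => (a + centred theta w) ^+ 2) = a ^+ 2 + covar theta theta.
Proof.
rewrite (_ : (fun w => _) = fun w => a ^+ 2 + (2 * a * centred theta w + centred theta w ^+ 2)).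
  rewrite ExD; last 2 first.
  - exact: integ_cst.
  - apply: integD; last exact: integ_centred2.
    by apply: integZ; exact: integ_centred.
  rewrite ExD; last 2 first.
  - by apply: integZ; exact: integ_centred.
  - exact: integ_centred2.
  rewrite Ex_cst ExZ; last exact: integ_centred.
  by rewrite Ex_centred mulr0 add0r covar_diag.
by apply/funext => w; ring.
Qed.

Lemma integ_shift4 (a : R) theta : integ P (fun w => (a + centred theta w) ^+ 4).
Proof.
apply: (integ_le P _ (fun w => 8 * a ^+ 4 + 8 * centred theta w ^+ 4)).
- apply: measurable_funX; apply: measurable_funD; first exact: measurable_cst.
  exact: measurable_centred.
- apply: integD; first exact: integ_cst.
  by apply: integZ; exact: integ_centred4.
move=> w; rewrite ger0_norm ?exprn_even_ge0//; set y := centred theta w.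
have h1 : (a + y) ^+ 2 <= 2 * a ^+ 2 + 2 * y ^+ 2 by have := sqr_ge0 (a - y); nra.
have h2 : ((a + y) ^+ 2) ^+ 2 <= (2 * a ^+ 2 + 2 * y ^+ 2) ^+ 2.
  by rewrite lerXn2r ?nnegrE ?sqr_ge0// addr_ge0// mulr_ge0 ?sqr_ge0.
rewrite (_ : (a + y) ^+ 4 = ((a + y) ^+ 2) ^+ 2); last by ring.
rewrite (_ : a ^+ 4 = (a ^+ 2) ^+ 2); last by ring.
rewrite (_ : y ^+ 4 = (y ^+ 2) ^+ 2); last by ring.
by have := sqr_ge0 (a ^+ 2 - y ^+ 2); nra.
Qed.

(** Kurtosis of the augmented vector.  The odd term 4 a Z^3 is split by AM-GM with
    weight 1 / k, k = sqrt kappa, and the comparison of the coefficients of a^2 s uses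
    k >= 1. *)
Lemma Ex_shift4_le (a : R) theta : 1 <= kappa ->
  Ex P (fun w => (a + centred theta w) ^+ 4) <=
  (Num.sqrt kappa + 1) ^+ 2 * (a ^+ 2 + covar theta theta) ^+ 2.
Proof.
move=> k1; pose k := Num.sqrt kappa.
have hk : 1 <= k by rewrite -[leLHS]sqrtr1 ler_sqrt//; lra.
have k2 : k ^+ 2 = kappa by rewrite sqr_sqrtr//; lra.
set s := covar theta theta; have s0 : 0 <= s := covar_ge0 theta.
have h4 := Ex_centred4_le theta; rewrite -/s -k2 in h4.
pose c4 := 1 + 2 / k; pose c2 := 2 * k * a ^+ 2 + 6 * a ^+ 2.
pose c1 := 4 * a ^+ 3.
have i1 : integ P (fun w => c1 * centred theta w) by apply: integZ; exact: integ_centred.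
have i2 : integ P (fun w => c2 * centred theta w ^+ 2) by apply: integZ; exact: integ_centred2.
have i4 : integ P (fun w => c4 * centred theta w ^+ 4) by apply: integZ; exact: integ_centred4.
have i0 : integ P (fun=> a ^+ 4) := integ_cst P (a ^+ 4).
have k0 : 0 < k by lra.
apply: (@le_trans _ _ (Ex P (fun w => a ^+ 4 + (c1 * centred theta w +
   (c2 * centred theta w ^+ 2 + c4 * centred theta w ^+ 4))))).
  apply: le_Ex.
  - exact: integ_shift4.
  - by apply: integD => //; apply: integD => //; exact: integD.
  move=> w; set y := centred theta w.
  rewrite -subr_ge0 (_ : _ - _ = 2 / k * y ^+ 2 * (y - k * a) ^+ 2).
    by apply: mulr_ge0; [apply: mulr_ge0; [rewrite divr_ge0 ?ltW | exact: sqr_ge0] | exact: sqr_ge0].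
  by rewrite /c1 /c2 /c4; field; rewrite gt_eqF.
rewrite ExD//; last by apply: integD => //; exact: integD.
rewrite ExD//; last exact: integD.
rewrite ExD// Ex_cst !ExZ; first last.
- exact: integ_centred.
- exact: integ_centred2.
- exact: integ_centred4.
rewrite Ex_centred mulr0 add0r -covar_diag -/s -/k.
have c40 : 0 <= c4 by rewrite /c4 addr_ge0// divr_ge0// ltW.
have := ler_wpM2l c40 h4.
rewrite (_ : c4 * (k ^+ 2 * s ^+ 2) = (k ^+ 2 + 2 * k) * s ^+ 2); last first.
  by rewrite /c4; field; rewrite gt_eqF.
have a20 := sqr_ge0 a.
have as0 : 0 <= a ^+ 2 * s by rewrite mulr_ge0.
have kk : 2 * k + 6 <= 2 * (k + 1) ^+ 2 by nra.
have := ler_wpM2r as0 kk.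
have a4 : a ^+ 4 <= (k + 1) ^+ 2 * a ^+ 4.
  by rewrite ler_peMl ?exprn_even_ge0//; nra.
have s20 := sqr_ge0 s.
rewrite /c2 (_ : (k + 1) ^+ 2 * (a ^+ 2 + s) ^+ 2 = (k + 1) ^+ 2 * a ^+ 4 +
  2 * (k + 1) ^+ 2 * (a ^+ 2 * s) + (k ^+ 2 + 2 * k) * s ^+ 2 + s ^+ 2); last by ring.
lra.
Qed.

(** The vectors f whiten X up to directions of zero variance, spanned by the r k.
    The identity for phi says that replacing theta by its whitened part does
    not change the variance. *)
Lemma whitening : exists (f r : 'I_d -> 'rV[R]_d),
  [/\ forall j, covar (f j) (f j) <= 1,
      forall theta, covar theta theta = \sum_j covar theta (f j) ^+ 2,
      forall theta, let phi := \sum_j covar theta (f j) *: f j in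
        covar phi phi = covar theta theta,
      forall k, covar (r k) (r k) = 0
    & forall theta (x : 'rV[R]_d), dot theta x =
        \sum_j covar theta (f j) * dot (f j) x +
        \sum_k theta ord0 k * dot (r k) x].
Proof.
pose e (i : nat) : 'rV[R]_d := \row_(j < d) (i == j)%:R.
have [f [fn fo fr]] := gram_schmidt covar covar_sym covar_lin covar_ge0 d e.
pose r (i : 'I_d) := e i - \sum_(k < d) covar (e i) (f k) *: f k.
have rE theta : theta = \sum_(j < d) covar theta (f j) *: f j +
    \sum_(k < d) theta ord0 k *: r k.
  have te : theta = \sum_(k < d) theta ord0 k *: e k.
    apply/rowP => j; rewrite summxE (bigD1 j)//= !mxE eqxx mulr1 big1 ?addr0//.
    by move=> k kj; rewrite !mxE (negbTE (_ : (k : nat) != j)) ?mulr0.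
  have cE j : covar theta (f j) = \sum_(k < d) theta ord0 k * covar (e k) (f j).
    by rewrite {1}te (form_sum covar covar_lin).
  rewrite {1}te; under [X in _ = X + _]eq_bigr do rewrite cE scaler_suml.
  rewrite exchange_big -big_split /=; apply: eq_bigr => k _.
  rewrite /r scalerBr scaler_sumr.
  under eq_bigr do rewrite -scalerA.
  by rewrite addrC subrK.
have r0 k : covar (r k) (r k) = 0 := fr k (ltn_ord k).
have null theta z : covar (\sum_(k < d) theta ord0 k *: r k) z = 0.
  rewrite (form_sum covar covar_lin _ _ _ (fun k : 'I_d => theta ord0 k)).
  apply: big1 => k _.
  by rewrite (form_null covar covar_sym covar_lin covar_ge0) ?mulr0.
have phiE theta z : covar (\sum_(j < d) covar theta (f j) *: f j) z = covar theta z.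
  by rewrite {2}[theta]rE (formD covar covar_lin) null addr0.
exists (fun j => f j), r; split => //.
- move=> j; case: (fn j (ltn_ord j)) => [->|->//].
  by rewrite (form0 covar covar_lin).
- move=> theta; rewrite -phiE.
  rewrite (form_sum covar covar_lin _ _ _ (fun k : 'I_d => covar theta (f k))).
  by apply: eq_bigr => j _; rewrite covar_sym expr2.
- by move=> theta phi; rewrite phiE covar_sym phiE.
move=> theta x; rewrite {1}[theta]rE dotDl !dot_suml.
by congr (_ + _); apply: eq_bigr => k _; rewrite dotZl.
Qed.

Lemma null_direction_as (Y : {RV P >-> borelRV R d}) theta :
  identically_distributed Y X -> covar theta theta = 0 ->
  exists A : set T, [/\ measurable A, P A = 1%E &
    forall w, A w -> dot theta ((Y w : 'rV[R]_d) - mean) = 0].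
Proof.
move=> YX t0.
have mD := measurable_dot_sub theta mean.
pose S : set (borelRV R d) := [set x | dot theta ((x : 'rV[R]_d) - mean) = 0].
have mS : measurable S.
  rewrite -[S]setTI; have := mD measurableT [set 0] (measurable_set1 0).
  by rewrite setTI.
exists (Y @^-1` S); split => //; first exact: measurable_funPTI.
have -> : P (Y @^-1` S) = P (X @^-1` S) := YX S mS.
have mC : measurable_fun setT (centred theta) := measurable_centred theta.
have /(ae_eq_integral_abs P measurableT) : measurable_fun [set: T]
    (EFin \o (fun w => centred theta w ^+ 2)).
  by apply/measurable_EFinP; exact: measurable_funX.
move=> [+ _]; rewrite (_ : integral _ _ _ = 0%E); last first.
  rewrite (eq_integral (fun w => (centred theta w ^+ 2)%:E)).
    by rewrite -EFin_Ex ?covar_diag -?covar_diag ?t0//; exact: integ_centred2.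
  by move=> w _ /=; rewrite ger0_norm ?sqr_ge0.
move=> /(_ erefl) [N [mN PN hN]].
have mXS : measurable (X @^-1` S) by exact: measurable_funPTI.
have N0 : P (~` (X @^-1` S)) = 0%E.
  apply: (subset_measure0 _ _ _ PN) => //; first exact: measurableC.
  move=> w hw; apply: hN => /= h; apply: hw; apply/eqP.
  by have /(_ Logic.I)[/eqP] := h; rewrite sqrf_eq0.
by rewrite -[X @^-1` S]setCK probability_setC ?N0 ?sube0//; exact: measurableC.
Qed.

Lemma ae_constant : kappa < 1 ->
  exists x : 'rV[R]_d, {ae P, forall w, X w = x}.
Proof.
move=> k1; exists mean.
have [A [mA PA hA]] := finite_almost_sure P 'I_d
  (fun k w => dot (delta_mx ord0 k) ((X w : 'rV[R]_d) - mean) = 0)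
  (fun k => null_direction_as X (delta_mx ord0 k) (fun _ _ => erefl) (covar_eq0 k1 _)).
exists (~` A); split; first exact: measurableC.
  by rewrite probability_setC// PA subee.
move=> w; apply: contra_not => Aw; apply/rowP => j; apply/eqP.
rewrite -subr_eq0; have := hA w Aw j.
rewrite /dot (bigD1 j)//= big1 => [|i ij]; last by rewrite !mxE eqxx (negbTE ij) mul0r.
by rewrite !mxE !eqxx mul1r addr0 => ->.
Qed.

End Moments.

(** * From the sign of the criterion to the estimator *)

Section EstimatorBounds.
Context {R : realType} {d n : nat} (kappa eps : R) (x : 'I_n -> 'rV[R]_d).
Let lam := lambda d n kappa eps.
Let crit (theta : 'rV[R]_d) (xi rho : R) : R :=
  \sum_(i < n) psi (lam * ((dot theta (x i) - xi) ^+ 2 / rho - 1)).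

Let lam0 : 0 <= lam. Proof. exact: sqrtr_ge0. Qed.

Let crit_noninc theta xi rho rho' : 0 < rho -> rho <= rho' ->
  crit theta xi rho' <= crit theta xi rho.
Proof.
move=> r0 rr; apply: ler_sum => i _; apply: psi_nondecreasing.
apply: ler_wpM2l => //; rewrite lerD2r ler_wpM2l ?sqr_ge0//.
by rewrite lef_pV2 ?posrE//; apply: lt_le_trans rr.
Qed.

(** One positive value of the criterion per shift is enough, by monotonicity
    in rho. *)
Lemma Nhat_ge theta (N : R) :
  (forall xi, exists2 rho, N <= rho & 0 < crit theta xi rho) ->
  (N%:E <= Nhat kappa eps x theta)%E.
Proof.
move=> h; apply: le_ereal_inf_tmp => _ [xi _ <-].
apply: le_ereal_inf_tmp => _ [rho [r0 hr] <-]; rewrite lee_fin leNgt; apply/negP => rN.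
have [rho' Nr' hr'] := h xi.
have := crit_noninc theta xi rho rho' r0 (ltW (lt_le_trans rN Nr')).
by move/(lt_le_trans hr'); rewrite ltNge hr.
Qed.

Lemma Nhat_le theta xi rho : 0 < rho -> crit theta xi rho <= 0 ->
  (Nhat kappa eps x theta <= rho%:E)%E.
Proof.
move=> r0 hr; apply: ge_ereal_inf.
exists (ereal_inf [set rho%:E | rho in [set rho : R |
      0 < rho /\ crit theta xi rho <= 0]]); first by exists xi.
by apply: ereal_inf_lbound; exists rho.
Qed.

Lemma Nhat_ge0 theta : (0 <= Nhat kappa eps x theta)%E.
Proof.
apply: le_ereal_inf_tmp => _ [xi _ <-].
by apply: le_ereal_inf_tmp => _ [rho [r0 hr] <-]; rewrite lee_fin ltW.
Qed.

Lemma Nhat_constant theta xi : (forall i, dot theta (x i) = xi) ->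
  Nhat kappa eps x theta = 0%E.
Proof.
move=> h; apply/eqP; rewrite eq_le Nhat_ge0 andbT.
apply/lee_addgt0Pr => e e0; rewrite add0e; apply: (Nhat_le _ xi) => //.
apply: sumr_le0 => i _; apply: psi_le0.
by rewrite h subrr expr0n mul0r sub0r mulrN mulr1 oppr_le0.
Qed.

End EstimatorBounds.

(** When e >= 1 the ratio 0, reached at h = +oo, is still within e of 1. *)
Lemma ediv_ratio {R : realType} (N e : R) (h : \bar R) : 0 < N -> 0 <= e ->
  ((N / (1 + e))%:E <= h)%E -> (e < 1 -> (h <= (N / (1 - e))%:E)%E) ->
  (`| ediv N%:E h - 1 | <= e%:E)%E.
Proof.
move=> N0 e0 h1 h2.
have t0 : 0 < N / (1 + e) by rewrite divr_gt0//; lra.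
rewrite /ediv eqe gt_eqF//=.
case: h h1 h2 => [r| |//]; last first.
  move=> _ h2; rewrite invey mule0 -EFinB /= lee_fin sub0r normrN normr1 leNgt.
  by apply/negP => /h2.
rewrite lee_fin => h1 h2.
have r0 : 0 < r := lt_le_trans t0 h1.
rewrite inver gt_eqF// -EFinM -EFinB lee_fin ler_norml.
have u : N / r <= 1 + e.
  by move: h1; rewrite !ler_pdivrMr//; lra.
have l : 1 - e <= N / r.
  have [e1|e1] := ltP e 1; last by apply: (@le_trans _ _ 0); [lra | rewrite divr_ge0 ?ltW].
  have := h2 e1; rewrite lee_fin ler_pdivlMr ?ler_pdivlMr//; lra.
by lra.
Qed.

(** * The constants in the sample size condition *)

Section Constants.
Context {R : realType}.

Lemma sqrt2_le : Num.sqrt (2 : R) <= 99 / 70.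
Proof.
have h : (2 : R) <= (99 / 70) ^+ 2 by lra.
apply: le_trans (ler_wsqrtr h) _.
by rewrite sqrtr_sqr ger0_norm//; lra.
Qed.

Section Fixed.
Variables (d n : nat) (kappa eps : R).
Hypothesis kappa0 : 0 < kappa.
Hypothesis eps01 : 0 < eps < 1.
Hypothesis size : sample_size_bound d kappa eps < n%:R.

Let k : R := Num.sqrt kappa.
Let q : R := kappa + 2 * k.
Let D : R := d.+1%:R.
Let L : R := log_term d eps.
Let lam : R := lambda d n kappa eps.
Let sn : R := Num.sqrt (n%:R : R).
Let b : R := Num.sqrt (2 * q / n%:R * L).
Let bet : R := 681 / 100 * (k + 1) * Num.sqrt (2 * D / n%:R).
Let g : R := (k + 1) * Num.sqrt D / sn.

Let k0 : 0 < k. Proof. by rewrite sqrtr_gt0. Qed.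

Lemma excess_gt0 : 0 < q. Proof.
by rewrite /q; have := k0; have := kappa0; lra.
Qed.

(** (k + 1)^2 bounds the kurtosis of the augmented vector; q is its excess over 1. *)
Lemma excessE : q = (k + 1) ^+ 2 - 1.
Proof. by rewrite /q sqrrD sqr_sqrtr ?ltW//; ring. Qed.

Let D1 : 1 <= D. Proof. by rewrite ler1n. Qed.

Let ln_eps : 0 < ln eps^-1.
Proof.
have /andP[e0 e1] := eps01.
by rewrite lnV ?posrE// oppr_gt0 ln_lt0// e0.
Qed.

Let L_ge : 73 / 100 * D <= L.
Proof. by rewrite /L /log_term -/D; have := ln_eps; lra. Qed.

Let L0 : 0 < L. Proof. by have := L_ge; have := D1; lra. Qed.

Lemma sample_gt0 : (0 < n)%N.
Proof.
rewrite -(ltr0n R); apply: le_lt_trans size; exact: sqr_ge0.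
Qed.

Let n0 : 0 < n%:R :> R. Proof. by rewrite ltr0n sample_gt0. Qed.

Let sn0 : 0 < sn. Proof. by rewrite sqrtr_gt0. Qed.

Let g0 : 0 <= g.
Proof.
by apply: divr_ge0; [apply: mulr_ge0; [have := k0; lra | exact: sqrtr_ge0] | exact: sqrtr_ge0].
Qed.

Lemma lambda_gt0 : 0 < lam.
Proof.
rewrite sqrtr_gt0; apply: mulr_gt0 L0; apply: divr_gt0 => //.
exact: mulr_gt0 excess_gt0 n0.
Qed.

Lemma lambda_sqr : n%:R * lam ^+ 2 * q = 2 * L.
Proof.
have q0 := excess_gt0; have L0' := L0; have n0' := n0.
rewrite /lam /lambda sqr_sqrtr -/q -/L; last first.
  by apply: mulr_ge0; [apply: divr_ge0 => //; apply: mulr_ge0|]; exact: ltW.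
by field; rewrite !gt_eqF.
Qed.

Lemma sqrt_term1E : b = lam * q.
Proof.
have q0 := excess_gt0; have L0' := L0; have n0' := n0.
rewrite -[RHS]ger0_norm; last by rewrite mulr_ge0 ?ltW// lambda_gt0.
rewrite -sqrtr_sqr; congr Num.sqrt.
have := lambda_sqr => h.
have -> : (lam * q) ^+ 2 = (n%:R * lam ^+ 2 * q) * q / n%:R by field; rewrite gt_eqF.
by rewrite h; field; rewrite gt_eqF.
Qed.

Let b0 : 0 < b. Proof. by rewrite sqrt_term1E mulr_gt0// ?lambda_gt0 ?excess_gt0. Qed.

Lemma sqrt_term2_ge0 : 0 <= bet.
Proof.
apply: mulr_ge0; last exact: sqrtr_ge0.
by apply: mulr_ge0; have := k0; lra.
Qed.

Lemma muE : mu d n kappa eps = b + bet. Proof. by []. Qed.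

Let bet_g : bet <= 681 / 100 * (99 / 70) * g.
Proof.
have D0 : 0 <= D by have := D1; lra.
rewrite /bet /g (_ : 2 * D / n%:R = 2 * (D * n%:R^-1)); last by ring.
rewrite sqrtrM// sqrtrM// sqrtrV -/sn; last exact: ltW n0.
rewrite (_ : 681 / 100 * (k + 1) * (Num.sqrt 2 * (Num.sqrt D / sn)) =
  681 / 100 * Num.sqrt 2 * ((k + 1) * Num.sqrt D / sn)); last by ring.
rewrite -/g.
 apply: ler_wpM2r; first exact: g0.
by apply: ler_wpM2l; [lra | exact: sqrt2_le].
Qed.

Let size_g : 20 * g + (5 / 2 + 1 / (2 * q)) * b < 1.
Proof.
have q0 := excess_gt0.
have h : 20 * (k + 1) * Num.sqrt D + (5 / 2 + 1 / (2 * q)) * Num.sqrt (2 * q * L) < sn.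
  rewrite -[ltLHS]ger0_norm; last first.
    apply: addr_ge0; apply: mulr_ge0; rewrite ?sqrtr_ge0//.
      by have := k0; lra.
    by rewrite addr_ge0// divr_ge0// mulr_ge0// ltW.
  by rewrite -sqrtr_sqr ltr_sqrt// n0.
have bE : b = Num.sqrt (2 * q * L) / sn.
  rewrite /b (_ : 2 * q / n%:R * L = 2 * q * L * n%:R^-1); last by ring.
  rewrite sqrtrM; last by rewrite !mulr_ge0 ?ltW// L0.
  by rewrite sqrtrV// ltW.
rewrite /g bE (_ : _ + _ = (20 * (k + 1) * Num.sqrt D +
  (5 / 2 + 1 / (2 * q)) * Num.sqrt (2 * q * L)) / sn); last by ring.
rewrite ltr_pdivrMr; last exact: sn0.
by rewrite [ltRHS]mul1r.
Qed.

(** The sample size condition in the form used below; 4 * 6.81 * sqrt 2 < 40 is where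
    the constant 20 comes from. *)
Lemma sqrt_terms_lt2 : 4 * bet + (5 + 1 / q) * b < 2.
Proof.
have := bet_g; have := size_g; have := g0.
rewrite (_ : 1 / (2 * q) = 1 / q / 2); last by field; rewrite gt_eqF// excess_gt0.
lra.
Qed.

(** A bound on mu away from 1/2, needed to keep 1 / (1 - 2 mu) under a numerical
    constant. *)
Lemma mu_le : 2 * mu d n kappa eps <= 97 / 100.
Proof.
have := bet_g; have := size_g; have := g0; have := b0; rewrite muE.
have : 0 <= 1 / (2 * q) * b.
  by rewrite mulr_ge0 ?divr_ge0 ?mulr_ge0 ?ltW// excess_gt0.
lra.
Qed.

Lemma mu_gt0 : 0 < mu d n kappa eps.
Proof. by rewrite muE; have := b0; have := sqrt_term2_ge0; lra. Qed.

Let z : R := lam * Num.sqrt (n%:R * (k + 1) ^+ 2 / (2 * D)).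

(** z^2 = (L / D) (1 + 1 / q) with L >= 0.73 D, and 0.85^2 < 0.73. *)
Lemma noise_scale_ge : 17 / 20 <= z.
Proof.
have q0 := excess_gt0; have l0 := lambda_gt0; have D1' := D1.
have D0 : 0 < D by lra.
have r0 : 0 <= n%:R * (k + 1) ^+ 2 / (2 * D).
  apply: divr_ge0; last lra.
  by apply: mulr_ge0; [exact: ltW n0 | exact: sqr_ge0].
have z0 : 0 <= z by rewrite mulr_ge0 ?sqrtr_ge0 ?ltW.
have z2 : z ^+ 2 = L / D * ((k + 1) ^+ 2 / q).
  rewrite /z exprMn (sqr_sqrtr r0).
  have -> : lam ^+ 2 * (n%:R * (k + 1) ^+ 2 / (2 * D)) =
     (n%:R * lam ^+ 2 * q) * (k + 1) ^+ 2 / (2 * D * q) by field; rewrite !gt_eqF.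
  by rewrite lambda_sqr; field; rewrite !gt_eqF.
have h1 : 73 / 100 <= L / D by rewrite ler_pdivlMr//; exact: L_ge.
have h2 : 1 <= (k + 1) ^+ 2 / q by rewrite ler_pdivlMr// excessE; lra.
have : 73 / 100 <= z ^+ 2.
  by rewrite z2 -[leLHS]mulr1 ler_pM//; lra.
have [//|zlt] := leP (17 / 20) z; nra.
Qed.

(** The bound of [uniform_deviation] in units of n lam: with lam q = b and
    n lam^2 q = 2 L, the entropy term L equals half of n lam b, and the leftover
    0.73 D is absorbed into L. *)
Lemma deviation_budgetE (sg t Tm : R) :
  n%:R * (sg * lam * (t - 1) + lam ^+ 2 / 2 * ((k + 1) ^+ 2 * t ^+ 2 - 2 * t + 1)) +
    D * (1362 / 100 * (z * Tm) + 73 / 100) - ln eps =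
  n%:R * lam * (sg * (t - 1) + b / 2 * (t ^+ 2 + 1) + b / (2 * q) * (t - 1) ^+ 2 + bet * Tm).
Proof.
have q0 := excess_gt0; have D1' := D1; have D0 : 0 < D by lra.
have /andP[e0 e1] := eps01.
have LE : D * (73 / 100) - ln eps = n%:R * lam ^+ 2 * q / 2.
  by rewrite lambda_sqr /L /log_term lnV ?posrE// -/D; field.
have zE : D * (1362 / 100 * z) = n%:R * lam * bet.
  have sE : Num.sqrt (n%:R * (k + 1) ^+ 2 / (2 * D)) * (2 * D) =
      n%:R * ((k + 1) * Num.sqrt (2 * D / n%:R)).
    have k1 : 0 <= k + 1 by have := k0; lra.
    have D2 : 0 <= 2 * D by lra.
    have n0' := n0.
    rewrite -[LHS]ger0_norm; last by rewrite mulr_ge0 ?sqrtr_ge0.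
    rewrite -[RHS]ger0_norm; last first.
      by apply: mulr_ge0; [exact: ltW | apply: mulr_ge0; rewrite ?sqrtr_ge0].
    rewrite -!sqrtr_sqr; congr Num.sqrt; rewrite !exprMn !sqr_sqrtr.
    - by field; rewrite !gt_eqF.
    - by rewrite divr_ge0// ltW.
    - by rewrite divr_ge0// mulr_ge0 ?sqr_ge0// ltW.
  rewrite /z /bet.
  rewrite (_ : D * (1362 / 100 * (lam * Num.sqrt (n%:R * (k + 1) ^+ 2 / (2 * D)))) =
    681 / 100 * lam * (Num.sqrt (n%:R * (k + 1) ^+ 2 / (2 * D)) * (2 * D))); last by field.
  by rewrite sE; ring.
have -> : D * (1362 / 100 * (z * Tm) + 73 / 100) =
  D * (1362 / 100 * z) * Tm + D * (73 / 100) by ring.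
rewrite -[LHS]addrA -[X in _ + X]addrA LE zE sqrt_term1E.
rewrite (_ : (k + 1) ^+ 2 = q + 1); last by rewrite excessE; ring.
by field; rewrite gt_eqF.
Qed.

Let w : R := 1 - 2 * mu d n kappa eps.
Let eta : R := mu d n kappa eps / w.

Let w0 : 0 < w. Proof. by rewrite /w; have := mu_le; lra. Qed.

Lemma eta_gt0 : 0 < eta. Proof. by rewrite divr_gt0// mu_gt0. Qed.

(** After multiplication by 2 (1 - 2 mu)^2 the bracket is exactly
    mu^2 (4 bet + (5 + 1 / q) b - 2). *)
Lemma lower_budget_lt0 (t := 1 + eta) :
  n%:R * lam * (-1 * (t - 1) + b / 2 * (t ^+ 2 + 1) + b / (2 * q) * (t - 1) ^+ 2 + bet * t) < 0.
Proof.
have q0 := excess_gt0; have w0' := w0.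
rewrite pmulr_rlt0; last exact: mulr_gt0 n0 lambda_gt0.
rewrite -(pmulr_rlt0 _ (_ : 0 < 2 * w ^+ 2)); last by rewrite mulr_gt0// exprn_gt0.
have -> : 2 * w ^+ 2 * (-1 * (t - 1) + b / 2 * (t ^+ 2 + 1) + b / (2 * q) * (t - 1) ^+ 2 + bet * t) =
  - 2 * (eta * w) * w + b * ((w + eta * w) ^+ 2 + w ^+ 2) +
  b / q * (eta * w) ^+ 2 + 2 * bet * (w + eta * w) * w.
  by rewrite /t; field; rewrite gt_eqF.
have -> : eta * w = b + bet by rewrite /eta muE mulfVK// gt_eqF.
have -> : - 2 * (b + bet) * w + b * ((w + (b + bet)) ^+ 2 + w ^+ 2) +
    b / q * (b + bet) ^+ 2 + 2 * bet * (w + (b + bet)) * w =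
    (b + bet) ^+ 2 * (4 * bet + (5 + 1 / q) * b - 2).
  by rewrite /w muE; field; rewrite gt_eqF.
have m0 := mu_gt0; rewrite muE in m0.
by rewrite pmulr_rlt0 ?exprn_gt0// subr_lt0 sqrt_terms_lt2.
Qed.

(** The bracket is at most b + bet - eta = mu - eta, since the quadratic corrections
    are favourable for eta < 1. *)
Lemma upper_budget_le0 (t := 1 - eta) : 1 <= kappa -> eta < 1 ->
  n%:R * lam * (1 * (t - 1) + b / 2 * (t ^+ 2 + 1) + b / (2 * q) * (t - 1) ^+ 2 + bet * 1) <= 0.
Proof.
move=> k1 e1; have q0 := excess_gt0; have e0 := eta_gt0; have b0' := b0.
rewrite pmulr_rle0; last exact: mulr_gt0 n0 lambda_gt0.
have mue : b + bet <= eta.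
  rewrite -muE /eta ler_pdivlMr; last exact: w0.
  by have := mu_gt0; rewrite /w; nra.
have q3 : 1 / q <= 1.
  by rewrite ler_pdivrMr// mul1r /q; have := k0; lra.
have -> : 1 * (t - 1) + b / 2 * (t ^+ 2 + 1) + b / (2 * q) * (t - 1) ^+ 2 + bet * 1 =
  - eta + b + bet - b * (eta * (2 - eta * (1 + 1 / q)) / 2).
  by rewrite /t; field; rewrite gt_eqF.
have : 0 <= b * (eta * (2 - eta * (1 + 1 / q)) / 2).
  apply: mulr_ge0; first exact: ltW.
  apply: divr_ge0 => //; apply: mulr_ge0; first exact: ltW.
  have : eta * (1 + 1 / q) <= 1 * 2.
    by apply: ler_pM; [exact: ltW | rewrite addr_ge0// divr_ge0// ltW | exact: ltW | lra].
  lra.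
lra.
Qed.

Lemma rate : (0 < d)%N -> 1 <= kappa ->
  eta <= 1100 * Num.sqrt (kappa * (d%:R + ln eps^-1) / n%:R).
Proof.
move=> d0 k1.
have q0 := excess_gt0; have n0' := n0; have l0 := ln_eps; have D1' := D1; have k0' := k0.
set s := Num.sqrt (kappa * (d%:R + ln eps^-1) / n%:R).
have dd : 1 <= d%:R :> R by rewrite ler1n.
have DE : D = d%:R + 1 by rewrite /D -natr1.
have arg0 : 0 <= kappa * (d%:R + ln eps^-1) / n%:R.
  by apply: divr_ge0; [apply: mulr_ge0; lra | exact: ltW].
have s0 : 0 <= s by exact: sqrtr_ge0.
have s2 : s ^+ 2 = kappa * (d%:R + ln eps^-1) / n%:R by rewrite sqr_sqrtr.
have kk : k <= kappa.
  have k2 : k ^+ 2 = kappa by rewrite sqr_sqrtr// ltW.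
  have : 1 <= k by rewrite -[leLHS]sqrtr1 ler_sqrt//; lra.
  by rewrite -k2; nra.
have k2 : k ^+ 2 = kappa by rewrite sqr_sqrtr// ltW.
have ni : 0 <= n%:R^-1 :> R by rewrite invr_ge0 ltW.
have qL : q * L <= 3 * kappa * (2 * (d%:R + ln eps^-1)).
  apply: ler_pM; [exact: ltW | exact: ltW L0 | rewrite /q; lra |].
  by rewrite /L /log_term -/D DE; lra.
have hb : b <= 4 * s.
  have hs : 0 <= 4 * s by lra.
  rewrite -[leRHS]ger0_norm// -sqrtr_sqr ler_wsqrtr// exprMn s2.
  rewrite (_ : 2 * q / n%:R * L = (2 * (q * L)) * n%:R^-1); last by ring.
  rewrite (_ : 4 ^+ 2 * (kappa * (d%:R + ln eps^-1) / n%:R) =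
    (16 * (kappa * (d%:R + ln eps^-1))) * n%:R^-1); last by ring.
  rewrite ler_wpM2r//.
  have : 0 <= kappa * (d%:R + ln eps^-1) by rewrite mulr_ge0//; lra.
  lra.
have hbet : bet <= 28 * s.
  have hk : 0 <= 681 / 100 * (k + 1) by lra.
  have D2n : 0 <= 2 * D / n%:R by rewrite divr_ge0 ?ltW//; lra.
  rewrite -[leLHS]ger0_norm; last exact: sqrt_term2_ge0.
  rewrite -sqrtr_sqr -[leRHS]ger0_norm; last lra.
  rewrite -sqrtr_sqr ler_wsqrtr// /bet exprMn sqr_sqrtr//.
 rewrite [(28 * s) ^+ 2]exprMn s2.
  rewrite (_ : (681 / 100 * (k + 1)) ^+ 2 * (2 * D / n%:R) =
    ((681 / 100) ^+ 2 * 2) * ((k + 1) ^+ 2 * D) * n%:R^-1); last by ring.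
  rewrite (_ : 28 ^+ 2 * (kappa * (d%:R + ln eps^-1) / n%:R) =
    (28 ^+ 2 / 8) * ((4 * kappa) * (2 * (d%:R + ln eps^-1))) * n%:R^-1); last first.
    by move: (ln _) => l; field; rewrite gt_eqF.
  rewrite ler_wpM2r//; apply: ler_pM; [lra | | lra |].
    by rewrite mulr_ge0 ?sqr_ge0//; lra.
  apply: ler_pM; [exact: sqr_ge0 | lra | | rewrite DE; lra].
  by rewrite sqrrD k2; lra.
rewrite /eta ler_pdivrMr; last exact: w0.
have := mu_le; have := mu_gt0; rewrite /w muE => h1 h2.
have : s * (3 / 100) <= s * (1 - 2 * (b + bet)) by apply: ler_wpM2l => //; lra.
by rewrite -mulrA; lra.
Qed.

End Fixed.
End Constants.

(** * The event of the theorem *)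

Section MainEvent.
Context {R : realType} {disp : measure_display} {T : measurableType disp}.
Context (P : probability T R) (d n : nat) (kappa eps : R).
Context (X : {RV P >-> borelRV R d}) (Xs : 'I_n -> {RV P >-> borelRV R d}).
Hypothesis copies : independent_copies Xs X.
Hypothesis X2 : ('E_P[fun w => (enorm (X w : 'rV[R]_d) ^+ 2)%R] < +oo)%E.
Hypothesis kappa0 : 0 < kappa.
Hypothesis kurtosis : forall theta : 'rV[R]_d,
  (central_moment P 4 X theta <= kappa%:E * central_moment P 2 X theta ^+ 2)%E.
Hypothesis eps01 : 0 < eps < 1.
Hypothesis size : sample_size_bound d kappa eps < n%:R.

Let m := mean P d X.
Let cov := covar P d X.
Let q : R := kappa + 2 * Num.sqrt kappa.
Let lam : R := lambda d n kappa eps.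
Let b : R := Num.sqrt (2 * q / n%:R * log_term d eps).
Let bet : R := 681 / 100 * (Num.sqrt kappa + 1) * Num.sqrt (2 * d.+1%:R / n%:R).

Lemma sample_null_as : exists A, [/\ measurable A, P A = 1%E &
  forall w, A w -> forall i theta, cov theta theta = 0 ->
    dot theta (Xs i w : 'rV[R]_d) = dot theta m].
Proof.
have [f [r [_ cE _ r0 dec]]] := whitening P d X X2.
have [A [mA PA hA]] := finite_almost_sure P ('I_n * 'I_d)%type
  (fun ik w => dot (r ik.2) ((Xs ik.1 w : 'rV[R]_d) - m) = 0)
  (fun ik => null_direction_as P d X X2 (Xs ik.1) (r ik.2) (copies.2 ik.1) (r0 ik.2)).
exists A; split => // w Aw i theta t0.
apply/eqP; rewrite -subr_eq0 -dotBr dec big1 => [|j _].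
  by rewrite add0r big1// => k _; rewrite (hA w Aw (i, k)) mulr0.
have : cov theta (f j) ^+ 2 <= 0.
  rewrite -t0 /cov cE (bigD1 j)//= lerDl.
  by apply: sumr_ge0 => k _; exact: sqr_ge0.
rewrite le_eqVlt ltNge sqr_ge0 orbF sqrf_eq0 => /eqP h.
by rewrite (h : covar P d X theta (f j) = 0) mul0r.
Qed.

(** Translation of [uniform_deviation] to the original variables: dividing
    <theta, x> - xi by sqrt (M / t) gives a linear form in the whitened coordinates
    whose coefficient vector has squared norm and second moment both equal to t. *)
Lemma sphere_deviation (sg Tm : R) : 1 <= kappa -> sg ^+ 2 = 1 -> 1 <= Tm ->
  exists A, [/\ measurable A, ((1 - eps)%:E <= P A)%E &
  forall w, A w -> forall theta xi t, 0 < t <= Tm ->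
    let M := cov theta theta + (dot theta m - xi) ^+ 2 in 0 < M ->
    \sum_i psi (sg * lam * ((dot theta (Xs i w : 'rV[R]_d) - xi) ^+ 2 / (M / t) - 1)) <=
    n%:R * lam * (sg * (t - 1) + b / 2 * (t ^+ 2 + 1) + b / (2 * q) * (t - 1) ^+ 2 + bet * Tm)].
Proof.
move=> k1 sg2 Tm1.
have [f [r [f1 cE phiE r0 dec]]] := whitening P d X X2.
have hk : 0 <= Num.sqrt kappa by exact: sqrtr_ge0.
have hk2 : Num.sqrt kappa ^+ 2 = kappa by rewrite sqr_sqrtr// ltW.
pose kp := (Num.sqrt kappa + 1) ^+ 2.
have kpk : kappa <= kp by rewrite /kp sqrrD hk2; lra.
have kp1 : 1 <= kp by lra.
pose u (x : borelRV R d) (i : 'I_d.+1) : R :=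
  if unlift ord0 i is Some j then dot (f j) ((x : 'rV[R]_d) - m) else 1.
have uX w i : u (X w) i = if unlift ord0 i is Some j then centred P d X (f j) w else 1.
  by [].
have sumE (v : 'I_d.+1 -> R) x : \sum_i v i * u x i =
    v ord0 + \sum_j v (lift ord0 j) * dot (f j) ((x : 'rV[R]_d) - m).
  rewrite big_ord_recl /u unlift_none mulr1; congr (_ + _).
  by apply: eq_bigr => j _; rewrite liftK.
have mu j : measurable_fun setT (fun x => u x j).
  rewrite /u; case: unliftP => [k _|_]; last exact: measurable_cst.
  exact: measurable_dot_sub.
have u4 j : integ P (fun w => u (X w) j ^+ 4).
  rewrite /u; case: unliftP => [k _|_]; last by rewrite expr1n; exact: integ_cst.
  exact: (integ_centred4 P d X kappa X2 kurtosis).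
have Eu4 j : Ex P (fun w => u (X w) j ^+ 4) <= kp.
  rewrite /u; case: unliftP => [k _|_]; last by rewrite expr1n Ex_cst.
  apply: le_trans (Ex_centred4_le P d X kappa X2 kurtosis (f k)) _.
  apply: le_trans kpk; rewrite ger_pMr// expr_le1//; exact: covar_ge0.
have I0 : (0 < #|'I_d.+1|)%N by rewrite card_ord.
have kp0 : 0 < kp by lra.
have /andP[eps0 _] := eps01.
have lam0 := lambda_gt0 d n kappa eps kappa0 eps01 size.
have n0 := sample_gt0 d n kappa eps size.
have hz := noise_scale_ge d n kappa eps kappa0 eps01 size.
have hz' : 17 / 20 <= lam * Num.sqrt (n%:R * kp / (2 * #|'I_d.+1|%:R)).
  by rewrite card_ord.
have [A [mA PA hA]] := uniform_deviation P n Xs X u kp copies mu u4 Eu4 I0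
  lam sg Tm eps sg2 eps0 Tm1 lam0 kp0 n0 hz'.
have [A0 [mA0 PA0 hA0]] := sample_null_as.
exists (A `&` A0); split; first exact: measurableI.
  rewrite -[eps]addr0; apply: probability_setI_ge => //.
  by rewrite PA0 subr0.
move=> w [Aw A0w] theta xi t /andP[t0 tT] M M0.
have rho0 : 0 < M / t by rewrite divr_gt0.
pose s := Num.sqrt (M / t).
have s0 : 0 < s by rewrite sqrtr_gt0.
have s2 : s ^+ 2 = M / t by rewrite sqr_sqrtr// ltW.
pose a := (dot theta m - xi) / s.
pose v (i : 'I_d.+1) : R := if unlift ord0 i is Some j then cov theta (f j) / s else a.
have v0 : v ord0 = a by rewrite /v unlift_none.
have vl j : v (lift ord0 j) = cov theta (f j) / s by rewrite /v liftK.
pose phi := \sum_j cov theta (f j) *: f j.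
have yE x : \sum_i v i * u x i = a + dot (s^-1 *: phi) ((x : 'rV[R]_d) - m).
  rewrite sumE v0 dotZl dot_suml mulr_sumr; congr (_ + _).
  by apply: eq_bigr => j _; rewrite vl dotZl; ring.
have cphi : cov (s^-1 *: phi) (s^-1 *: phi) = cov theta theta / (M / t).
  have lin := covar_lin P d X X2.
  have pE : cov phi phi = cov theta theta := phiE theta.
  rewrite /cov (formZ _ lin) covar_sym (formZ _ lin) -/cov pE -s2.
  by field; rewrite gt_eqF.
have aM : a ^+ 2 + cov theta theta / (M / t) = t.
  rewrite /a expr_div_n s2 -mulrDl addrC -/M.
  by field; rewrite !gt_eqF.
have vt : \sum_i v i ^+ 2 <= Tm.
  rewrite big_ord_recl v0; under eq_bigr do rewrite vl expr_div_n.
  by rewrite -mulr_suml -cE s2 aM.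
have E2 : Ex P (fun w => (\sum_i v i * u (X w) i) ^+ 2) = t.
  rewrite -[RHS]aM -cphi -(Ex_shift2 P d X X2).
  by congr (Ex P _); apply/funext => w'; rewrite yE.
have E4 : Ex P (fun w => (\sum_i v i * u (X w) i) ^+ 4) <= kp * t ^+ 2.
  rewrite -[X in _ * X ^+ 2]aM -cphi.
  apply: le_trans (Ex_shift4_le P d X kappa X2 kurtosis a (s^-1 *: phi) k1).
  by rewrite le_eqVlt; apply/orP; left; apply/eqP; congr (Ex P _); apply/funext => w'; rewrite yE.
have t01 : 0 < t <= Tm by rewrite t0.
have := hA w Aw v t vt t01 E2 E4.
rewrite card_ord (deviation_budgetE d n kappa eps kappa0 eps01 size).
apply: le_trans; rewrite le_eqVlt; apply/orP; left; apply/eqP.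
apply: eq_bigr => i _; congr (psi (_ * (_ - 1))).
rewrite -s2 -expr_div_n; congr (_ ^+ 2).
rewrite yE dotZl.
have -> : dot phi ((Xs i w : 'rV[R]_d) - m) = dot theta ((Xs i w : 'rV[R]_d) - m).
  rewrite (dec theta) dot_suml [X in _ = _ + X]big1 ?addr0.
    by apply: eq_bigr => j _; rewrite dotZl.
  by move=> k _; rewrite dotBr (hA0 w A0w i (r k) (r0 k)) subrr mulr0.
by rewrite /a dotBr; field; rewrite gt_eqF.
Qed.

(** The lower bound on the estimator uses the criterion with psi reversed, by oddness,
    and all shifts; the upper bound only uses the shift xi = <theta, E X>. *)
Lemma ratio_event : exists A : set T,
  [/\ measurable A, ((1 - 2 * eps)%:E <= P A)%E
    & forall w, A w -> forall theta : 'rV[R]_d,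
      (`| ediv (central_moment P 2 X theta)
            (Nhat kappa eps (fun i => Xs i w : 'rV[R]_d) theta) - 1 |
       <= (mu d n kappa eps / (1 - 2 * mu d n kappa eps))%:E)%E].
Proof.
have /andP[eps0 _] := eps01.
pose eta := mu d n kappa eps / (1 - 2 * mu d n kappa eps).
have eta0 : 0 < eta := eta_gt0 d n kappa eps kappa0 eps01 size.
have [A0 [mA0 PA0 hA0]] := sample_null_as.
have degenerate w theta : A0 w -> cov theta theta = 0 ->
    (`| ediv (central_moment P 2 X theta)
          (Nhat kappa eps (fun i => Xs i w : 'rV[R]_d) theta) - 1 | <= eta%:E)%E.
  move=> A0w c0; rewrite (central_moment2E P d X X2) -/cov c0.
  rewrite (Nhat_constant _ _ _ _ (dot theta m)); last by move=> i; exact: hA0.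
  by rewrite /ediv !eqxx /= subrr normr0 lee_fin ltW.
have [k1|k1] := ltP kappa 1.
  exists A0; split => // [|w A0w theta].
    by rewrite PA0 lee_fin; lra.
  by apply: degenerate => //; exact: (covar_eq0 P d X kappa X2 kurtosis k1).
have T1 : 1 <= 1 + eta by lra.
have sgN : (-1 : R) ^+ 2 = 1 by rewrite sqrrN expr1n.
have [Al [mAl PAl hAl]] := sphere_deviation (-1) (1 + eta) k1 sgN T1.
have [Au [mAu PAu hAu]] := sphere_deviation 1 1 k1 (expr1n _ _) (lexx 1).
exists (Al `&` Au `&` A0); split.
- by apply: measurableI => //; exact: measurableI.
- rewrite (_ : 2 * eps = (eps + eps) + 0); last by ring.
  apply: probability_setI_ge => //; first exact: measurableI.
    exact: probability_setI_ge.
  by rewrite PA0 subr0.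
move=> w [[Alw Auw] A0w] theta.
have [c0|cN0] := eqVneq (cov theta theta) 0; first exact: degenerate.
have c0 : 0 < cov theta theta by rewrite lt_neqAle eq_sym cN0 covar_ge0.
rewrite (central_moment2E P d X X2) -/cov -/eta.
apply: ediv_ratio => //; first exact: ltW.
- apply: Nhat_ge => xi.
  pose M := cov theta theta + (dot theta m - xi) ^+ 2.
  have M0 : 0 < M by rewrite ltr_wpDr// sqr_ge0.
  exists (M / (1 + eta)).
    by rewrite ler_pM2r ?invr_gt0 ?lerDl ?sqr_ge0//; lra.
  have te : 0 < 1 + eta <= 1 + eta by rewrite lexx andbT; lra.
  have := hAl w Alw theta xi (1 + eta) te M0.
  move/le_lt_trans => /(_ _ (lower_budget_lt0 d n kappa eps kappa0 eps01 size)).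
  rewrite -oppr_gt0 -sumrN; congr (0 < _).
  by apply: eq_bigr => i _; rewrite -psi_odd !mulN1r mulNr opprK.
- move=> e1.
  have te : 0 < 1 - eta <= 1 by apply/andP; split; lra.
  apply: (Nhat_le _ _ _ _ (dot theta m)); first by rewrite divr_gt0//; lra.
  pose M := cov theta theta + (dot theta m - dot theta m) ^+ 2.
  have ME : M = cov theta theta by rewrite /M subrr expr0n addr0.
  have M0 : 0 < M by rewrite ME.
  have := hAu w Auw theta (dot theta m) (1 - eta) te M0; rewrite -/M ME.
  move/le_trans => /(_ _ (upper_budget_le0 d n kappa eps kappa0 eps01 size k1 e1)).
  congr (_ <= 0).
  by apply: eq_bigr => i _; rewrite mul1r.
Qed.

End MainEvent.

Theorem proposition3p3 (R : realType) :
  exists c : R,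
  forall (disp : measure_display) (T : measurableType disp)
    (P : probability T R) (d n : nat) (kappa eps : R)
    (X : {RV P >-> borelRV R d}) (Xs : 'I_n -> {RV P >-> borelRV R d}),
  (0 < d)%N ->
  independent_copies Xs X ->
  ('E_P[fun w => (enorm (X w : 'rV[R]_d) ^+ 2)%R] < +oo)%E ->
  0 < kappa ->
  (forall theta : 'rV[R]_d,
    (central_moment P 4 X theta <=
     kappa%:E * central_moment P 2 X theta ^+ 2)%E) ->
  0 < eps < 1 ->
  sample_size_bound d kappa eps < n%:R ->
  [/\ exists A : set T,
        [/\ measurable A,
            ((1 - 2 * eps)%:E <= P A)%E
          & forall w, A w -> forall theta : 'rV[R]_d,
              (`| ediv (central_moment P 2 X theta)
                       (Nhat kappa eps (fun i => Xs i w : 'rV[R]_d) theta)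
                  - 1 |
               <= (mu d n kappa eps / (1 - 2 * mu d n kappa eps))%:E)%E],
      (~ exists x : 'rV[R]_d, {ae P, forall w, X w = x}) -> 1 <= kappa
    & 1 <= kappa ->
        mu d n kappa eps / (1 - 2 * mu d n kappa eps) <=
        c * Num.sqrt (kappa * (d%:R + ln eps^-1) / n%:R)].
Proof.
(* b <= 4 s, bet <= 28 s and 1 - 2 mu >= 3/100, where s is the target rate. *)
exists 1100 => disp T P d n kappa eps X Xs d0 copies X2 kappa0 kurtosis eps01 size.
split.
- exact: ratio_event.
- move=> nonconst; rewrite leNgt; apply/negP => k1; apply: nonconst.
  exact: (ae_constant P d X kappa X2 kurtosis k1).
- by move=> k1; exact: rate.
Qed.
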